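(* Fix $n$ and $\tau\in\mathcal A_n$. Suppose that for each dimension $d$, $Z_1,\ldots,Z_\tau\stackrel{iid}{\sim}F_1$ and, independently, $Z_{\tau+1},\ldots,Z_n\stackrel{iid}{\sim}F_2$, where $F_1=F_{1,d}$, $F_2=F_{2,d}$ are distributions on $\mathbb{R}^d$ with mean vectors $\mu_{1,d},\mu_{2,d}$ and covariance matrices $\Sigma_{1,d},\Sigma_{2,d}$ satisfying: (A1) the coordinate variables in $F_1$ and $F_2$ have uniformly bounded fourth moments; (A2) for all $r,s\in\{1,2\}$, if $Z\sim F_r$ and $Z_*\sim F_s$ are independent and $W=Z-Z_*$, then $\sum_{q\neq q'}\big|\mathrm{Corr}\big((W^{(q)})^2,(W^{(q')})^2\big)\big|=o(d^2)$ as $d\to\infty$. Also assume $\liminf_{d\to\infty}\min\{\mathrm{trace}(\Sigma_{1,d}),\mathrm{trace}(\Sigma_{2,d})\}/d>0$. If $\|\mu_{1,d}-\mu_{2,d}\|^2/v_d\to\infty$ or $|\mathrm{trace}(\Sigma_{1,d})-\mathrm{trace}(\Sigma_{2,d})|/v_d\to\infty$ as $d\to\infty$, then: (a) $\mathbb{P}(\widehat T_n=\tau)\to1$ as $d\to\infty$. (b) Let $\alpha\in(0,1)$. If $|\mathcal B(\rho_{n,\tau})|/n!\le\alpha$, then the change-point $\tau$ is detected (by $\widehat T_n$) at level $\alpha$ with probability converging to one, i.e. $\mathbb{P}(\widehat T_n=\tau,\ \widehat S_n>\widehat c_{1-\alpha})\to1$ as $d\to\infty$.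
   Context: $\|\cdot\|$ is the Euclidean norm; $W^{(q)}$ denotes the $q$-th coordinate. For $r,s\in\{1,2\}$, $v_{r,s,d}^2$ is the asymptotic order of $\mathrm{Var}(\|Z-Z_*\|^2)$ for independent $Z\sim F_r$, $Z_*\sim F_s$, i.e. a positive sequence with $\mathrm{Var}(\|Z-Z_*\|^2)\asymp v^2_{r,s,d}$ as $d\to\infty$ (ratio bounded away from $0$ and $\infty$), and $v_d^2=\max\{v^2_{1,1,d},v^2_{1,2,d},v^2_{2,2,d}\}$, $v_d>0$. For $2\le t\le n-2$ define $$T_{11}(t)=\binom t2^{-1}\sum_{1\le i<j\le t}\|Z_i-Z_j\|,\quad T_{22}(t)=\binom{n-t}2^{-1}\sum_{t+1\le i<j\le n}\|Z_i-Z_j\|,\quad T_{12}(t)=\frac1{t(n-t)}\sum_{i=1}^{t}\sum_{j=t+1}^{n}\|Z_i-Z_j\|,$$ $\mathcal D_n(t)=\{T_{12}(t)-T_{11}(t)\}^2+\{T_{12}(t)-T_{22}(t)\}^2$, and $w(t)=t(n-t)/n^2$. With $\delta_n\in(0,1/2)$ and $m=\lfloor n\delta_n\rfloor$ (usual floor, $m\ge2$ so that everything is defined), $\mathcal A_n=\{m,m+1,\ldots,n-m\}$. Define $\widehat S_n=\max_{t\in\mathcal A_n}w(t)\mathcal D_n(t)$ and $\widehat T_n\in\operatorname{argmax}_{t\in\mathcal A_n}w(t)\mathcal D_n(t)$. Permutation test: for a permutation $\pi$ of $\{1,\ldots,n\}$ let $\widehat S_n^{(\pi)}$ be $\widehat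 S_n$ computed from $Z_{\pi(1)},\ldots,Z_{\pi(n)}$, and $\widehat c_{1-\alpha}=\inf\{x\ge 0:\frac1{n!}\sum_\pi \mathbf 1[\widehat S_n^{(\pi)}\le x]\ge1-\alpha\}$. The potential change-point $\widehat T_n$ is a detected change-point at level $\alpha$ if $\widehat S_n>\widehat c_{1-\alpha}$. Unbalanced permutations: for a permutation $\pi$ and $t\in\mathcal A_n$ let $k_\pi(t)=\#\{i\le t:\pi(i)\le\tau\}$, $p_\pi(t)=k_\pi(t)/t$, $q_\pi(t)=(\tau-k_\pi(t))/(n-t)$. Define $$\rho_{n,\tau}=-2\frac{w(m)}{m-1}+\sqrt{4\Big(\frac{w(m)}{m-1}\Big)^2+2\Big\{w(\tau)-\frac{w(m)}{2(m-1)^2}\Big\}},$$ $\mathcal B(\rho_{n,\tau})=\{\pi:\max_{t\in\mathcal A_n}|p_\pi(t)-q_\pi(t)|>\rho_{n,\tau}\}$. *)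

(* Defs.v *)
From HB Require Import structures.
From mathcomp Require Import all_boot all_order all_algebra perm.
From mathcomp Require Import all_classical all_reals all_analysis.

Set Implicit Arguments.
Unset Strict Implicit.
Unset Printing Implicit Defensive.

Import Order.TTheory GRing.Theory Num.Theory.
Import numFieldNormedType.Exports.

Local Open Scope classical_set_scope.
Local Open Scope ring_scope.

(* R^d is d.-tuple R, which the library equips with the product Borel
   sigma-algebra (matrices have no measurable structure). *)

Definition sqdist (R : realType) (d : nat) (x y : d.-tuple R) : R :=
  \sum_(q < d) (tnth x q - tnth y q) ^+ 2.

Definition eucl_dist (R : realType) (d : nat) (x y : d.-tuple R) : R :=
  Num.sqrt (sqdist x y).

Definition mean_vector (R : realType) (d : nat)
    (F : probability (d.-tuple R) R) : d.-tuple R :=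
  [tuple fine ('E_F[(fun x : d.-tuple R => tnth x q)])%E | q < d].

Definition cov_matrix (R : realType) (d : nat)
    (F : probability (d.-tuple R) R) : 'M[R]_d :=
  \matrix_(q < d, q' < d)
    fine (covariance F (fun x => tnth x q) (fun x => tnth x q')).

(* If one of the two variances is 0, the correlation is 0 since a / 0 = 0. *)
Definition correlation (R : realType) (disp : measure_display)
    (T : measurableType disp) (P : probability T R) (X Y : T -> R) : R :=
  fine (covariance P X Y) /
  (Num.sqrt (fine ('V_P[X])%E) * Num.sqrt (fine ('V_P[Y])%E)).

(* Independent Z ~ F and Z_* ~ G are realized as the two coordinate maps on
   the product probability space F \x G. *)
Definition var_sqdist (R : realType) (d : nat)
    (F G : probability (d.-tuple R) R) : R :=
  fine ('V_(F \x G)[(fun z : d.-tuple R * d.-tuple R => sqdist z.1 z.2)])%E.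

Definition sqcoord_diff (R : realType) (d : nat) (q : 'I_d)
    (z : d.-tuple R * d.-tuple R) : R :=
  (tnth z.1 q - tnth z.2 q) ^+ 2.

Definition sum_abs_corr (R : realType) (d : nat)
    (F G : probability (d.-tuple R) R) : R :=
  \sum_(q < d) \sum_(q' < d | q != q')
    `|correlation (F \x G)%E (sqcoord_diff q) (sqcoord_diff q')|.

Definition same_order (R : realType) (u v : nat -> R) : Prop :=
  exists c C : R, 0 < c /\ \forall d \near \oo, c <= u d / v d <= C.

Definition mutually_independent (R : realType)
    (disp disp' : measure_display) (T : measurableType disp)
    (T' : measurableType disp') (P : probability T R) (n : nat)
    (Z : 'I_n -> {RV P >-> T'}) : Prop :=
  forall (J : {set 'I_n}) (A : 'I_n -> set T'),
    (forall i, measurable (A i)) ->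
    P [set x | forall i, i \in J -> A i (Z i x)] =
    (\prod_(i in J) P (Z i @^-1` A i))%E.

(* Observations are indexed from 0: the first t of them are the i < t. *)

Definition T11 (R : realType) (d n : nat) (z : 'I_n -> d.-tuple R) (t : nat)
    : R :=
  ('C(t, 2)%:R)^-1 *
  \sum_(i < n) \sum_(j < n | (i < j)%N && (j < t)%N) eucl_dist (z i) (z j).

Definition T22 (R : realType) (d n : nat) (z : 'I_n -> d.-tuple R) (t : nat)
    : R :=
  ('C(n - t, 2)%:R)^-1 *
  \sum_(i < n) \sum_(j < n | (t <= i)%N && (i < j)%N) eucl_dist (z i) (z j).

Definition T12 (R : realType) (d n : nat) (z : 'I_n -> d.-tuple R) (t : nat)
    : R :=
  ((t * (n - t))%N%:R)^-1 *
  \sum_(i < n | (i < t)%N) \sum_(j < n | (t <= j)%N) eucl_dist (z i) (z j).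

Definition Dstat (R : realType) (d n : nat) (z : 'I_n -> d.-tuple R) (t : nat)
    : R :=
  (T12 z t - T11 z t) ^+ 2 + (T12 z t - T22 z t) ^+ 2.

Definition weight (R : realType) (n t : nat) : R :=
  (t * (n - t))%N%:R / n%:R ^+ 2.

Definition objective (R : realType) (d n : nat) (z : 'I_n -> d.-tuple R)
    (t : nat) : R :=
  weight R n t * Dstat z t.

Definition trim (R : realType) (n : nat) (delta : R) : nat :=
  Num.truncn (n%:R * delta).

Definition admissible (n m t : nat) : bool := (m <= t <= n - m)%N.

(* The neutral element 0 is harmless: the objective is nonnegative. *)
Definition Shat (R : realType) (d n m : nat) (z : 'I_n -> d.-tuple R) : R :=
  \big[Num.max/0]_(m <= t < (n - m).+1) objective z t.

Definition is_argmax (R : realType) (d n m : nat) (z : 'I_n -> d.-tuple R)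
    (t : nat) : Prop :=
  admissible n m t /\
  forall t', admissible n m t' -> objective z t' <= objective z t.

Definition perm_quantile (R : realType) (d n m : nat)
    (z : 'I_n -> d.-tuple R) (alpha : R) : R :=
  inf [set x : R | 0 <= x /\
    1 - alpha <=
      (n`!%:R)^-1 * \sum_(pi : 'S_n) (Shat m (z \o pi) <= x)%R%:R].

Definition kcount (n tau : nat) (pi : 'S_n) (t : nat) : nat :=
  #|[pred i : 'I_n | (i < t)%N && (pi i < tau)%N]|.

Definition pprop (R : realType) (n tau : nat) (pi : 'S_n) (t : nat) : R :=
  (kcount tau pi t)%:R / t%:R.

Definition qprop (R : realType) (n tau : nat) (pi : 'S_n) (t : nat) : R :=
  (tau%:R - (kcount tau pi t)%:R) / (n%:R - t%:R).

Definition rho (R : realType) (n m tau : nat) : R :=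
  let wm := weight R n m in
  let m1 := m%:R - 1 in
  - 2 * (wm / m1) +
  Num.sqrt (4 * (wm / m1) ^+ 2 +
            2 * (weight R n tau - wm / (2 * m1 ^+ 2))).

Definition unbalanced (R : realType) (n m tau : nat) (r : R) : {set 'S_n} :=
  [set pi : 'S_n |
    r < \big[Num.max/0]_(m <= t < (n - m).+1)
          `|pprop R tau pi t - qprop R tau pi t| ].

(* Main.v *)
Require Import Defs.
From HB Require Import structures.
From mathcomp Require Import all_boot all_order all_algebra perm.
From mathcomp Require Import all_classical all_reals all_analysis.
From mathcomp Require Import measurable_realfun ring lra zify.

(** For [Z ~ F_r] and [Z_* ~ F_s] independent, [E|Z - Z_*|^2] is
    [E_rs = tr S_r + tr S_s + |mu_r - mu_s|^2]; it is of order [d], and by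
    Chebyshev [|Z - Z_*|^2] deviates from it by [O(v_d)].  Hence every pairwise
    distance is [a_rs = sqrt E_rs] up to [O(v_d / sqrt d)].  The signal
    [u = a_12 - a_11], [s = a_12 - a_22] satisfies
    [sqrt (u^2 + s^2) >= c (|mu_1 - mu_2|^2 + |tr S_1 - tr S_2|) / sqrt d],
    so the relative error tends to 0 and everything reduces to the noiseless
    statistics, in which a distance depends only on the classes of its two
    endpoints.  There the objective is an explicit function of the proportions
    [p, q] of the first class in the two segments.  For the identity
    permutation it is at most [(1 - 1/n) w(tau) (u^2 + s^2)] off [tau], where it
    equals [w(tau) (u^2 + s^2)]; for a balanced permutation it is at most
    [w(tau) - w(m) / (4 (m - 1)^2)] times [u^2 + s^2]. *)

Set Implicit Arguments.
Unset Strict Implicit.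
Unset Printing Implicit Defensive.

Import Order.TTheory GRing.Theory Num.Theory.
Import numFieldNormedType.Exports.

Local Open Scope classical_set_scope.
Local Open Scope ring_scope.

(** * Averages of a two-class kernel over index sets *)

Section Averages.
Context {R : realType} {I : finType}.
Implicit Types (A B c : pred I) (g : I -> I -> R).

Definition cross_avg A B g : R :=
  (#|A|%:R * #|B|%:R)^-1 * \sum_(i | A i) \sum_(j | B j) g i j.

(** Ordered pairs off the diagonal replace pairs [i < j]: the sum is then a full double sum minus
    its diagonal, and both are determined by the class counts. *)
Definition within_avg A g : R :=
  (#|A|%:R * (#|A|%:R - 1))^-1 * \sum_(i | A i) \sum_(j | A j && (j != i)) g i j.

Lemma cross_avg_le A B g h : (forall i j, A i -> B j -> g i j <= h i j) ->
  cross_avg A B g <= cross_avg A B h.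
Proof.
move=> gh; rewrite /cross_avg ler_wpM2l ?invr_ge0 ?mulr_ge0//.
by apply: ler_sum => i Ai; apply: ler_sum => j Bj; exact: gh.
Qed.

Lemma within_avg_le A g h : (0 < #|A|)%N -> (forall i j, i != j -> g i j <= h i j) ->
  within_avg A g <= within_avg A h.
Proof.
move=> A0 gh; rewrite /within_avg ler_wpM2l//.
  by rewrite invr_ge0 mulr_ge0// subr_ge0 ler1n.
apply: ler_sum => i Ai; apply: ler_sum => j /andP[Aj ji].
by apply: gh; rewrite eq_sym.
Qed.

Lemma sum_two_class A c (f : bool -> R) :
  \sum_(i | A i) f (c i) =
  #|[pred i | A i && c i]|%:R * f true +
  (#|A|%:R - #|[pred i | A i && c i]|%:R) * f false.
Proof.
rewrite (bigID c)/=.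
rewrite (eq_bigr (fun=> f true)); last by move=> i /andP[_ ->].
rewrite [X in _ + X](eq_bigr (fun=> f false)); last first.
  by move=> i /andP[_ /negbTE ->].
rewrite !sumr_const -[X in X + _]mulr_natl -[X in _ + X]mulr_natl.
rewrite -[#|A|](cardID c A).
have -> : #|[predI A & c]| = #|[pred i | A i && c i]| by apply: eq_card.
have -> : #|[predD A & c]| = #|(fun i => A i && ~~ c i)|.
  by apply: eq_card => i; rewrite !inE andbC.
rewrite natrD addrAC subrr add0r//.
Qed.

Section TwoClass.
Variables (c : pred I) (a : bool -> bool -> R).
Hypothesis asym : a true false = a false true.

Let frac A : R := #|[pred i | A i && c i]|%:R / #|A|%:R.
(** The excess of the between-class distance over the within-class ones, as in the energy distance;
    it is [u + s] in [gap]. *)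
Let e : R := 2 * a true false - a true true - a false false.

Lemma cross_avg_two_class A B : (0 < #|A|)%N -> (0 < #|B|)%N ->
  cross_avg A B (fun i j => a (c i) (c j)) =
  frac A * frac B * a true true +
  (frac A * (1 - frac B) + (1 - frac A) * frac B) * a true false +
  (1 - frac A) * (1 - frac B) * a false false.
Proof.
move=> A0 B0; rewrite /cross_avg.
under eq_bigr => i _ do rewrite (sum_two_class B c (a (c i))).
rewrite (sum_two_class A c (fun b => #|[pred i | B i && c i]|%:R * a b true +
   (#|B|%:R - #|[pred i | B i && c i]|%:R) * a b false)) -asym /frac.
by field; rewrite !pnatr_eq0 -!lt0n A0 B0.
Qed.

(** The first three terms are the mean for two draws with replacement. Drawing without replacement
    multiplies the probability of a mixed pair by [N / (N - 1)], with [N = #|A|], and this produces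
    the last term. *)
Lemma within_avg_two_class A : (1 < #|A|)%N ->
  within_avg A (fun i j => a (c i) (c j)) =
  frac A ^+ 2 * a true true + 2 * frac A * (1 - frac A) * a true false +
  (1 - frac A) ^+ 2 * a false false + frac A * (1 - frac A) * e / (#|A|%:R - 1).
Proof.
move=> A1; rewrite /within_avg.
have -> : \sum_(i | A i) \sum_(j | A j && (j != i)) a (c i) (c j) =
    \sum_(i | A i) \sum_(j | A j) a (c i) (c j) - \sum_(i | A i) a (c i) (c i).
  rewrite -sumrB; apply: eq_bigr => i Ai.
  by rewrite [X in _ = X - _](bigD1 i)//= addrAC subrr add0r.
under eq_bigr => i _ do rewrite (sum_two_class A c (a (c i))).
rewrite (sum_two_class A c (fun b => #|[pred i | A i && c i]|%:R * a b true +
   (#|A|%:R - #|[pred i | A i && c i]|%:R) * a b false)).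
rewrite (sum_two_class A c (fun b => a b b)) -asym /frac /e.
field.
by rewrite subr_eq0 pnatr_eq1 pnatr_eq0 -lt0n (ltn_trans _ A1)// neq_ltn A1 orbT.
Qed.

End TwoClass.
End Averages.

(** * The two-sample statistics as averages over segments *)

Section TwoSample.
Variable R : realType.

Lemma eucl_distC (d : nat) (x y : d.-tuple R) : eucl_dist x y = eucl_dist y x.
Proof.
by congr Num.sqrt; apply: eq_bigr => q _; rewrite -opprB sqrrN.
Qed.

Lemma card_ord_lt (n t : nat) : (t <= n)%N -> #|[pred i : 'I_n | (i < t)%N]| = t.
Proof.
by move=> tn; rewrite -sum1_card -(big_ord_widen _ (fun=> 1%N)) // sum1_card card_ord.
Qed.

Lemma card_ord_ge (n t : nat) :
  (t <= n)%N -> #|[pred i : 'I_n | (t <= i)%N]| = (n - t)%N.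
Proof.
move=> tn; have := cardC [pred i : 'I_n | (i < t)%N].
rewrite card_ord card_ord_lt// => H; rewrite -[X in (X - _)%N]H addKn.
by apply: eq_card => i; rewrite !inE -leqNgt.
Qed.

Lemma natr_bin2 (N : nat) : 'C(N, 2)%:R = N%:R * (N%:R - 1) / 2 :> R.
Proof.
apply: (canRL (mulfK _)); first by rewrite pnatr_eq0.
rewrite -natrM (bin_ffact N 2).
rewrite ffactnS ffactn1 natrM.
by case: N => [|N]; [rewrite !mul0r | rewrite -natr1 addrK].
Qed.

Lemma sum_ordered_pairs (n : nat) (A : pred 'I_n) (g : 'I_n -> 'I_n -> R) :
  (forall i j, g i j = g j i) ->
  \sum_(i | A i) \sum_(j | A j && (j != i)) g i j =
  2 * \sum_i \sum_(j | [&& A i, A j & (i < j)%N]) g i j.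
Proof.
move=> gC.
have -> : \sum_(i | A i) \sum_(j | A j && (j != i)) g i j =
    \sum_i \sum_(j | [&& A i, A j & (i < j)%N]) g i j +
    \sum_i \sum_(j | [&& A i, A j & (j < i)%N]) g i j.
  rewrite -big_split/= big_mkcond/=; apply: eq_bigr => i _.
  case: (A i) => /=; last by rewrite !big_pred0_eq addr0.
  rewrite (bigID (fun j : 'I_n => (i < j)%N))/=; congr (_ + _); apply: eq_bigl => j.
    by rewrite -andbA; congr (_ && _); rewrite -val_eqE/=; case: ltngtP.
  by rewrite -andbA; congr (_ && _); rewrite -val_eqE/=; case: ltngtP.
rewrite [X in _ + X](_ : _ = \sum_i \sum_(j | [&& A i, A j & (i < j)%N]) g i j).
  by rewrite mulr_natl mulr2n.
rewrite (exchange_big_dep xpredT)//=.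
apply: eq_bigr => i _; apply: eq_big => [j|j _]; last exact: gC.
by rewrite andbCA.
Qed.

Variables (d n : nat) (z : 'I_n -> d.-tuple R) (t : nat).
Hypothesis tn : (t <= n)%N.

Lemma T12E : T12 z t = cross_avg [pred i : 'I_n | (i < t)%N]
  [pred i : 'I_n | (t <= i)%N] (fun i j => eucl_dist (z i) (z j)).
Proof. by rewrite /cross_avg card_ord_lt// card_ord_ge// /T12 natrM. Qed.

Lemma T11E : T11 z t = within_avg [pred i : 'I_n | (i < t)%N]
  (fun i j => eucl_dist (z i) (z j)).
Proof.
rewrite /within_avg card_ord_lt// sum_ordered_pairs; last first.
  by move=> i j; exact: eucl_distC.
rewrite /T11 natr_bin2 invfM invrK -[LHS]mulrA; congr (_ * (_ * _)).
apply: eq_bigr => i _; apply: eq_bigl => j/=.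
by case: (ltnP i j) => ij; rewrite ?andbF//= andbT; case: (ltnP j t) => jt;
  rewrite ?andbF// (ltn_trans ij jt).
Qed.

Lemma T22E : T22 z t = within_avg [pred i : 'I_n | (t <= i)%N]
  (fun i j => eucl_dist (z i) (z j)).
Proof.
rewrite /within_avg card_ord_ge// sum_ordered_pairs; last first.
  by move=> i j; exact: eucl_distC.
rewrite /T22 natr_bin2 invfM invrK -[LHS]mulrA; congr (_ * (_ * _)).
apply: eq_bigr => i _; apply: eq_bigl => j/=.
by case: (ltnP i j) => ij; rewrite ?andbF//= ?andbT; case: (leqP t i) => jt//=;
  rewrite (leq_trans jt (ltnW ij)).
Qed.

End TwoSample.

(* The noiseless value of [T12 - T11]; swapping the two samples and the two
   segments, that of [T12 - T22] is [gap (1 - q) (1 - p) s u (n - t)]. *)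
Definition gap (R : realType) (p q u s : R) (N : nat) : R :=
  (p - q) * (p * u - (1 - p) * s) - p * (1 - p) * (u + s) / (N%:R - 1).

(** A permutation is a bijection, so exactly [tau] positions carry the first class; those not
    counted by [kcount] lie in the second segment. *)
Lemma qprop_frac (R : realType) (n tau t : nat) (pi : 'S_n) :
  (t <= n)%N -> (tau <= n)%N -> qprop R tau pi t =
  #|[pred i : 'I_n | (t <= i)%N && (pi i < tau)%N]|%:R /
  #|[pred i : 'I_n | (t <= i)%N]|%:R.
Proof.
move=> tn taun; rewrite card_ord_ge// natrB// /qprop /kcount; congr (_ / _).
have H : #|[pred i : 'I_n | (pi i < tau)%N]| = tau.
  rewrite -[RHS](card_ord_lt taun) -!sum1_card.
  by rewrite [RHS](reindex_inj (@perm_inj _ pi)).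
apply/eqP; rewrite subr_eq addrC -natrD; apply/eqP; congr (_%:R); rewrite -[LHS]H.
rewrite -(cardID [pred i : 'I_n | (i < t)%N] [pred i : 'I_n | (pi i < tau)%N]).
congr (_ + _)%N; apply: eq_card => i; rewrite !inE.
  by rewrite andbC.
by rewrite -leqNgt.
Qed.

(** * Stability of the statistics under errors in the distances *)

Section Perturbation.
Variables (R : realType) (d n tau t : nat) (z : 'I_n -> d.-tuple R) (pi : 'S_n).
Variables (a11 a12 a22 eps : R).
Hypotheses (t1 : (1 < t)%N) (nt1 : (1 < n - t)%N) (taun : (tau <= n)%N).

Let a (b b' : bool) : R :=
  if b then (if b' then a11 else a12) else (if b' then a12 else a22).

Hypothesis close : forall i j : 'I_n, i != j ->
  `|eucl_dist (z i) (z j) - a (i < tau)%N (j < tau)%N| <= eps.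

Let tn : (t <= n)%N. Proof. by rewrite ltnW// -subn_gt0 (ltn_trans _ nt1). Qed.
Let p := pprop R tau pi t.
Let q := qprop R tau pi t.

Let g (i j : 'I_n) := eucl_dist (z (pi i)) (z (pi j)).
Let c (i : 'I_n) := (pi i < tau)%N.
(** A constant shift keeps the two-class form. By monotonicity the averages of [g] lie between the
    explicit values for [r = - eps] and [r = eps]. *)
Let aD (r : R) (b b' : bool) := a b b' + r.

Let g_bounds (i j : 'I_n) : i != j ->
  aD (- eps) (c i) (c j) <= g i j <= aD eps (c i) (c j).
Proof.
move=> ij; have := close (i := pi i) (j := pi j).
rewrite (inj_eq (@perm_inj _ pi)) => /(_ ij).
by rewrite ler_distl.
Qed.

Let cross_bounds (A B : pred 'I_n) : (forall i j, A i -> B j -> i != j) ->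
  cross_avg A B (fun i j => aD (- eps) (c i) (c j)) <= cross_avg A B g <=
  cross_avg A B (fun i j => aD eps (c i) (c j)).
Proof.
by move=> AB; apply/andP; split; apply: cross_avg_le => i j Ai Bj;
  have /andP[] := g_bounds (AB _ _ Ai Bj).
Qed.

Let within_bounds (A : pred 'I_n) : (0 < #|A|)%N ->
  within_avg A (fun i j => aD (- eps) (c i) (c j)) <= within_avg A g <=
  within_avg A (fun i j => aD eps (c i) (c j)).
Proof.
by move=> A0; apply/andP; split; apply: within_avg_le => // i j ij;
  have /andP[] := g_bounds ij.
Qed.

Let disj (i j : 'I_n) : (i < t)%N -> (t <= j)%N -> i != j.
Proof. by move=> it tj; rewrite -val_eqE neq_ltn (leq_trans it tj). Qed.

Let t0 : (0 < t)%N. Proof. exact: ltn_trans t1. Qed.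
Let nt0 : (0 < n - t)%N. Proof. exact: ltn_trans nt1. Qed.

Let cross_aD (r : R) : cross_avg [pred i : 'I_n | (i < t)%N]
    [pred i : 'I_n | (t <= i)%N] (fun i j => aD r (c i) (c j)) =
  p * q * (a11 + r) + (p * (1 - q) + (1 - p) * q) * (a12 + r) +
  (1 - p) * (1 - q) * (a22 + r).
Proof.
by rewrite cross_avg_two_class ?card_ord_lt ?card_ord_ge// /q qprop_frac// card_ord_ge.
Qed.

Let first_aD (r : R) : within_avg [pred i : 'I_n | (i < t)%N]
    (fun i j => aD r (c i) (c j)) =
  p ^+ 2 * (a11 + r) + 2 * p * (1 - p) * (a12 + r) + (1 - p) ^+ 2 * (a22 + r) +
  p * (1 - p) * (2 * (a12 + r) - (a11 + r) - (a22 + r)) / (t%:R - 1).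
Proof. by rewrite within_avg_two_class ?card_ord_lt. Qed.

Let second_aD (r : R) : within_avg [pred i : 'I_n | (t <= i)%N]
    (fun i j => aD r (c i) (c j)) =
  q ^+ 2 * (a11 + r) + 2 * q * (1 - q) * (a12 + r) + (1 - q) ^+ 2 * (a22 + r) +
  q * (1 - q) * (2 * (a12 + r) - (a11 + r) - (a22 + r)) / ((n - t)%:R - 1).
Proof.
by rewrite within_avg_two_class ?card_ord_ge// /q qprop_frac// card_ord_ge.
Qed.

(** In the noiseless averages the class weights sum to 1 and the shift cancels from the
    [1 / (t - 1)] correction, so each average moves by at most [eps]. Subtracting the two gives
    [2 * eps]. *)
Lemma gap_first : `|T12 (z \o pi) t - T11 (z \o pi) t -
  gap p q (a12 - a11) (a12 - a22) t| <= 2 * eps.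
Proof.
rewrite T12E// T11E//.
have := cross_bounds disj; have := within_bounds (A := [pred i : 'I_n | (i < t)%N]).
rewrite card_ord_lt// !cross_aD !first_aD => /(_ t0) /andP[l1 l2] /andP[l3 l4].
set W := within_avg _ _ in l1 l2 *; set X := cross_avg _ _ _ in l3 l4 *.
rewrite ler_distl /gap; set N := (t%:R - 1)^-1 in l1 l2 *.
apply/andP; split; nra.
Qed.

Lemma gap_second : `|T12 (z \o pi) t - T22 (z \o pi) t -
  gap (1 - q) (1 - p) (a12 - a22) (a12 - a11) (n - t)| <= 2 * eps.
Proof.
rewrite T12E// T22E//.
have := cross_bounds disj; have := within_bounds (A := [pred i : 'I_n | (t <= i)%N]).
rewrite card_ord_ge// !cross_aD !second_aD => /(_ nt0) /andP[l1 l2] /andP[l3 l4].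
set W := within_avg _ _ in l1 l2 *; set X := cross_avg _ _ _ in l3 l4 *.
rewrite ler_distl /gap; set N := ((n - t)%:R - 1)^-1 in l1 l2 *.
apply/andP; split; nra.
Qed.
End Perturbation.

(** * Bounds on the noiseless differences *)

Section GapBounds.
Variable R : realType.
Implicit Types (p q u s w b : R).

(** This serves splits in which one segment contains a single class. With [c = k / (k + l - 1)] the
    second gap is [b * ((1 - c) * s - c * u)]. The claim then follows from [u ^+ 2 + ((1 - c) * s -
    c * u) ^+ 2 <= (1 + c) * (u ^+ 2 + s ^+ 2)] and [b * (1 + c) <= 1]. *)
Lemma gap_edge (k l : nat) u s : (0 < l)%N -> (1 < k + l)%N ->
  forall b, b = l%:R / (k + l)%:R ->
  (b * u) ^+ 2 + gap b 0 s u (k + l) ^+ 2 <= b * (u ^+ 2 + s ^+ 2).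
Proof.
move=> l0 kl1 b b_def.
have N0 : 0 < (k + l)%:R :> R by rewrite ltr0n (ltn_trans _ kl1).
have N1 : 0 < (k + l)%:R - 1 :> R by rewrite subr_gt0 ltr1n.
have b0 : 0 <= b by rewrite b_def divr_ge0.
set c : R := k%:R / ((k + l)%:R - 1).
have c0 : 0 <= c by rewrite /c divr_ge0// ltW.
have l1 : 1 <= l%:R :> R by rewrite ler1n.
have c1 : c <= 1 by rewrite /c ler_pdivrMr// mul1r natrD; lra.
have -> : gap b 0 s u (k + l) = b * ((1 - c) * s - c * u).
  rewrite /gap b_def /c natrD; field.
  by rewrite -natrD !gt_eqF// -natrD.
have bc : b * (1 + c) <= 1.
  have -> : b * (1 + c) = l%:R * ((k + l)%:R - 1 + k%:R) /
      ((k + l)%:R * ((k + l)%:R - 1)).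
    by rewrite b_def /c; field; rewrite -natrD !gt_eqF.
  rewrite ler_pdivrMr ?mulr_gt0// mul1r natrD.
  (* After clearing denominators, [b * (1 + c) <= 1] is exactly [0 <= k * (k - 1)], which holds
     because [k] is a natural number. *)
  have k1 : 0 <= k%:R * (k%:R - 1) :> R.
    by case: k {kl1 N0 N1 b b_def b0 c c0 c1} => [|k]; rewrite ?mul0r// -natr1 addrK mulr_ge0// natr1.
  nra.
have h : u ^+ 2 + ((1 - c) * s - c * u) ^+ 2 <= (1 + c) * (u ^+ 2 + s ^+ 2).
  clearbody c; have : 0 <= c * (1 - c) * (u + s) ^+ 2 by rewrite mulr_ge0 ?sqr_ge0 ?mulr_ge0 ?subr_ge0.
  have : 0 <= c * s ^+ 2 by rewrite mulr_ge0 ?sqr_ge0.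
  nra.
rewrite !exprMn -mulrDr expr2 -mulrA ler_wpM2l//.
apply: (le_trans (ler_wpM2l b0 h)); rewrite mulrA.
by rewrite ler_piMl// addr_ge0 ?sqr_ge0.
Qed.

(** The three summands bound the main, cross and correction terms of the expanded square. The
    constants come from [w <= 1/4], [p * (1 - p) <= 1/4], and from bounding [X ^+ 2] by [M2] and
    both [(u + s) ^+ 2] and [X * (u + s)] by [2 * M2]. *)
Lemma gap_ub p q u s (N : nat) w r A B : 0 <= p <= 1 -> `|p - q| <= r ->
  (1 < N)%N -> 0 <= w -> w <= 4^-1 -> w / (N%:R - 1) <= A ->
  w / (N%:R - 1) ^+ 2 <= B ->
  w * gap p q u s N ^+ 2 <= (r ^+ 2 / 4 + A * r + B / 8) * (u ^+ 2 + s ^+ 2).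
Proof.
move=> /andP[p0 p1] pqr N1 w0 w4 wA wB.
have NN : 0 < N%:R - 1 :> R by rewrite subr_gt0 ltr1n.
set X := p * u - (1 - p) * s; set M2 := u ^+ 2 + s ^+ 2.
set c := p * (1 - p).
have c0 : 0 <= c by rewrite mulr_ge0 ?subr_ge0.
have c4 : c <= 4^-1 by rewrite /c; have := sqr_ge0 (2 * p - 1); nra.
have M0 : 0 <= M2 by rewrite addr_ge0 ?sqr_ge0.
have XM : X ^+ 2 <= M2.
  have : 0 <= c * (u + s) ^+ 2 by rewrite mulr_ge0 ?sqr_ge0.
  have : 0 <= (1 - p) * u ^+ 2 by rewrite mulr_ge0 ?sqr_ge0 ?subr_ge0.
  have : 0 <= p * s ^+ 2 by rewrite mulr_ge0 ?sqr_ge0.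
  rewrite /M2 /X /c; nra.
have eM : (u + s) ^+ 2 <= 2 * M2 by have := sqr_ge0 (u - s); rewrite /M2; nra.
have Xe : `|X * (u + s)| <= 2 * M2.
  by rewrite ler_norml; apply/andP; split;
    [have := sqr_ge0 (X + (u + s)) | have := sqr_ge0 (X - (u + s))]; nra.
have -> : w * gap p q u s N ^+ 2 = w * ((p - q) ^+ 2 * X ^+ 2) +
    2 * (w / (N%:R - 1)) * c * (- (p - q) * (X * (u + s))) +
    w / (N%:R - 1) ^+ 2 * (c ^+ 2 * (u + s) ^+ 2).
  by rewrite /gap -/X -/c; field; rewrite gt_eqF.
clearbody X M2 c.
rewrite [leRHS](_ : _ = r ^+ 2 / 4 * M2 + A * r * M2 + B / 8 * M2); last by rewrite -!mulrDl.
apply: lerD; first apply: lerD.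
- have -> : r ^+ 2 / 4 * M2 = 4^-1 * (r ^+ 2 * M2) by ring.
  apply: ler_pM => //; first by rewrite mulr_ge0 ?sqr_ge0.
  apply: ler_pM; rewrite ?sqr_ge0//.
  by rewrite -real_normK ?num_real// ler_sqr ?nnegrE// (le_trans _ pqr).
- have -> : A * r * M2 = 2 * A * 4^-1 * (r * (2 * M2)) by field.
  apply: le_trans (_ : 2 * (w / (N%:R - 1)) * c * (r * (2 * M2)) <= _).
    apply: ler_wpM2l.
      by rewrite !mulr_ge0// invr_ge0 ltW.
    by apply: le_trans (ler_norm _) _; rewrite normrM normrN ler_pM.
  have r0 : 0 <= r by exact: le_trans pqr.
  apply: ler_wpM2r; first by rewrite !mulr_ge0.
  by apply: ler_pM => //; rewrite ?ler_pM2l// !mulr_ge0// invr_ge0 ltW.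
- have -> : B / 8 * M2 = B * (16^-1 * (2 * M2)) by field.
  apply: ler_pM => //; first by rewrite divr_ge0// sqr_ge0.
    by rewrite mulr_ge0 ?sqr_ge0.
  apply: ler_pM; rewrite ?sqr_ge0//; nra.
Qed.

Lemma gap_norm_le p q u s (N : nat) M : 0 <= p <= 1 -> 0 <= q <= 1 -> (1 < N)%N ->
  `|u| <= M -> `|s| <= M -> `|gap p q u s N| <= 5 * M.
Proof.
move=> /andP[p0 p1] /andP[q0 q1] N1 uM sM.
have NN : 1 <= N%:R - 1 :> R by rewrite lerBrDr -[1 + 1]/(2%:R) ler_nat.
have N0 : 0 < N%:R - 1 :> R by rewrite (lt_le_trans _ NN).
have M0 : 0 <= M by exact: le_trans uM.
rewrite /gap; apply: le_trans (ler_normB _ _) _.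
(* Each of the two terms of [gap] is at most [2 * M]; the last [M] is slack. *)
have -> : 5 * M = 1 * (M + M) + 1 * 1 * (M + M) + M by ring.
apply: (@le_trans _ _ (1 * (M + M) + 1 * 1 * (M + M))); last by rewrite lerDl.
apply: lerD.
- rewrite normrM; apply: ler_pM => //.
    by rewrite ler_norml; apply/andP; split; lra.
  apply: le_trans (ler_normB _ _) _; rewrite !normrM.
  by apply: lerD; rewrite -[leRHS]mul1r; apply: ler_pM => //; rewrite ger0_norm; lra.
- rewrite -mulrA -mulrA mulrA normrM; apply: ler_pM => //.
    rewrite normrM; apply: ler_pM => //; rewrite ger0_norm; lra.
  rewrite normrM -[leRHS]mulr1; apply: ler_pM => //.
    by apply: le_trans (ler_normD _ _) _; exact: lerD.
  by rewrite ger0_norm ?invr_ge0 ?(ltW N0)// invf_le1.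
Qed.

Lemma sqr_perturb (x y M th : R) : 0 <= M -> 0 <= th <= 1 -> `|x| <= 5 * M ->
  `|y - x| <= 2 * (th * M) -> `|y ^+ 2 - x ^+ 2| <= 24 * (th * M ^+ 2).
Proof.
move=> M0 /andP[th0 th1] xM yx.
have -> : y ^+ 2 - x ^+ 2 = (y - x) * (2 * x + (y - x)) by ring.
rewrite normrM.
have -> : 24 * (th * M ^+ 2) = 2 * (th * M) * (2 * (5 * M) + 2 * (1 * M)) by ring.
apply: ler_pM => //; apply: le_trans (ler_normD _ _) _; apply: lerD.
  by rewrite normrM ger0_norm ?ler_pM2l.
apply: (le_trans yx); rewrite ler_pM2l//; exact: ler_wpM2r.
Qed.

End GapBounds.

(** * Monotonicity of the weights over admissible splits *)

Section Weights.
Variables (R : realType) (n m : nat).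
Hypothesis m2 : (2 <= m)%N.
Local Notation w := (weight R n).

Lemma weight_ge0 t : 0 <= w t.
Proof. by rewrite /weight divr_ge0// exprn_ge0. Qed.

Lemma weight_sym t : (t <= n)%N -> w (n - t) = w t.
Proof. by move=> tn; rewrite /weight subKn// mulnC. Qed.

Lemma weight_le t : (t <= n)%N -> w t <= 4^-1.
Proof.
move=> tn; rewrite /weight; have [->|n0] := posnP n.
  by rewrite sub0n muln0 mul0r.
rewrite ler_pdivrMr ?exprn_gt0 ?ltr0n// natrM natrB//.
have := sqr_ge0 (n%:R - 2 * t%:R : R); nra.
Qed.

Section Admissible.
Variable t : nat.
Hypothesis mt : admissible n m t.

Lemma admissible_le : (t <= n)%N.
Proof. by have /andP[] := mt; lia. Qed.

Lemma admissible_gt1 : (1 < t)%N.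
Proof. by have /andP[] := mt; lia. Qed.

Lemma admissible_subn_gt1 : (1 < n - t)%N.
Proof. by have /andP[] := mt; lia. Qed.

Lemma admissible_sym : admissible n m (n - t).
Proof. by have := mt; rewrite /admissible; lia. Qed.

Lemma weight_gt0 : 0 < w t.
Proof.
have := admissible_subn_gt1; have := admissible_gt1 => t1 nt1.
by rewrite /weight divr_gt0 ?exprn_gt0 ?ltr0n//; lia.
Qed.

Let m1 : 0 < m%:R - 1 :> R. Proof. by rewrite subr_gt0 ltr1n. Qed.
Let t1 : 0 < t%:R - 1 :> R.
Proof. by rewrite subr_gt0 ltr1n admissible_gt1. Qed.

Lemma weight_ratio_le : w t / (t%:R - 1) <= w m / (m%:R - 1).
Proof.
have /andP[mt' tm] := mt.
rewrite ler_pdivrMr// mulrAC ler_pdivlMr// /weight.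
rewrite ![_ / n%:R ^+ 2 * _]mulrAC ler_wpM2r ?invr_ge0 ?exprn_ge0//.
(* With [t = m + x] and [n - t = m + y], the difference of the two cross-multiplied sides is
   [m ^ 2 * x + m * x ^ 2 + x * y], whose terms are all nonnegative. *)
have [x tx] : exists x, t = (m + x)%N by exists (t - m)%N; lia.
have [y ny] : exists y, (n - t = m + y)%N by exists (n - t - m)%N; lia.
have nm : (n - m = m + x + y)%N by lia.
rewrite ny nm tx !natrM !natrD.
have x0 : 0 <= x%:R :> R by []; have y0 : 0 <= y%:R :> R by [].
have mx : 0 <= m%:R * (m%:R * x%:R) :> R by rewrite !mulr_ge0.
have mxx : 0 <= m%:R * (x%:R * x%:R) :> R by rewrite !mulr_ge0.
have xy : 0 <= x%:R * y%:R :> R by rewrite !mulr_ge0.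
nra.
Qed.

Lemma weight_ratio2_le : w t / (t%:R - 1) ^+ 2 <= w m / (m%:R - 1) ^+ 2.
Proof.
have /andP[mt' tm] := mt.
rewrite !expr2 !invfM !mulrA; apply: ler_pM.
- by rewrite divr_ge0 ?weight_ge0 ?ltW.
- by rewrite invr_ge0 ltW.
- exact: weight_ratio_le.
- by rewrite lef_pV2 ?posrE// lerB// ler_nat.
Qed.

End Admissible.
End Weights.

(** * Class proportions of the two segments *)

Section Proportions.
Variables (R : realType) (n tau : nat) (pi : 'S_n) (t : nat).
Hypotheses (tn : (t < n)%N) (t0 : (0 < t)%N) (taun : (tau <= n)%N).

Lemma kcount_le : (kcount tau pi t <= t)%N.
Proof.
rewrite -[X in (_ <= X)%N](card_ord_lt (ltnW tn)).
by rewrite ?/kcount; apply/subset_leq_card/fintype.subsetP => i; rewrite !inE => /andP[].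
Qed.

Lemma pprop_ge0_le1 : 0 <= pprop R tau pi t <= 1.
Proof.
by rewrite /pprop divr_ge0//= ler_pdivrMr ?ltr0n// mul1r ler_nat kcount_le.
Qed.

Lemma qprop_ge0_le1 : 0 <= qprop R tau pi t <= 1.
Proof.
rewrite qprop_frac ?(ltnW tn)// card_ord_ge ?(ltnW tn)//.
rewrite divr_ge0//= ler_pdivrMr ?ltr0n ?subn_gt0// mul1r ler_nat.
rewrite -[X in (_ <= X)%N](card_ord_ge (ltnW tn)).
by rewrite ?/kcount; apply/subset_leq_card/fintype.subsetP => i; rewrite !inE => /andP[].
Qed.

Lemma kcount1 : kcount tau (1%g : 'S_n) t = minn t tau.
Proof.
rewrite -[RHS](@card_ord_lt n); last by rewrite geq_min (ltnW tn).
by apply: eq_card => i; rewrite !inE perm1 leq_min.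
Qed.

End Proportions.

(** * Deterministic separation of the true split from its competitors *)

Section Separation.
Variables (R : realType) (n m tau : nat).
Hypotheses (m2 : (2 <= m)%N) (mtau : admissible n m tau).
Local Notation w := (weight R n).
Local Notation A := (w m / (m%:R - 1)).
Local Notation B := (w m / (m%:R - 1) ^+ 2).

Definition noiseless_objective (pi : 'S_n) (t : nat) (u s : R) : R :=
  w t * (gap (pprop R tau pi t) (qprop R tau pi t) u s t ^+ 2 +
   gap (1 - qprop R tau pi t) (1 - pprop R tau pi t) s u (n - t) ^+ 2).

Lemma noiseless_objective_tau u s : noiseless_objective 1%g tau u s = w tau * (u ^+ 2 + s ^+ 2).
Proof.
have tau1 := admissible_gt1 m2 mtau; have ntau1 := admissible_subn_gt1 m2 mtau.
rewrite /noiseless_objective /pprop /qprop kcount1; last by lia.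
rewrite minnn subrr mul0r divff ?pnatr_eq0 -?lt0n ?(ltn_trans _ tau1)//.
by rewrite /gap; congr (_ * (_ + _)); ring.
Qed.

(** Off [tau] one segment is pure, and [gap_edge] applies with [b] the share, in the mixed segment,
    of the class absent from the pure one. For [t < tau] this gives
    [w t * b = t * (n - tau) / n ^ 2], below [w tau] by at least [(n - tau) / n ^ 2], which is at
    least [w tau / n]. The case [tau < t] is symmetric. *)
Lemma noiseless_objective_identity_le t u s : admissible n m t -> t != tau ->
  noiseless_objective 1%g t u s <= (w tau - w tau / n%:R) * (u ^+ 2 + s ^+ 2).
Proof.
move=> mt ttau.
have tn := admissible_le m2 mt; have taun := admissible_le m2 mtau.
have t1 := admissible_gt1 m2 mt; have nt1 := admissible_subn_gt1 m2 mt.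
have tau1 := admissible_gt1 m2 mtau; have ntau1 := admissible_subn_gt1 m2 mtau.
have M0 : 0 <= u ^+ 2 + s ^+ 2 by rewrite addr_ge0 ?sqr_ge0.
have n0 : 0 < n%:R :> R by rewrite ltr0n; lia.
have t0 : 0 < t%:R :> R by rewrite ltr0n; lia.
have tau0 : 0 < tau%:R :> R by rewrite ltr0n; lia.
have nt0 : 0 < n%:R - t%:R :> R by rewrite -natrB// ltr0n; lia.
have ntau0 : 0 < n%:R - tau%:R :> R by rewrite -natrB// ltr0n; lia.
rewrite /noiseless_objective /pprop /qprop kcount1; last by lia.
have [ltt|ltt|/eqP] := ltngtP t tau; last by rewrite (negbTE ttau).
- rewrite divff ?gt_eqF//.
  set q : R := _ / _.
  have -> : gap 1 q u s t = (1 - q) * u by rewrite /gap; ring.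
  have b_def : 1 - q = (n - tau)%:R / ((tau - t) + (n - tau))%:R.
    have -> : ((tau - t) + (n - tau) = n - t)%N by lia.
    by rewrite /q !natrB//; field; rewrite gt_eqF.
  have := @gap_edge R (tau - t) (n - tau) u s _ _ _ b_def.
  have -> : ((tau - t) + (n - tau) = n - t)%N by lia.
  rewrite subrr => /(_ _ _)/(ler_wpM2l (weight_ge0 R n t)) H.
  apply: le_trans (H _ _) _; [lia..|].
  rewrite mulrA ler_wpM2r//.
  have -> : w t * (1 - q) = t%:R / n%:R * ((n%:R - tau%:R) / n%:R).
    by rewrite /weight natrM natrB// /q; field; rewrite !gt_eqF.
  have -> : w tau - w tau / n%:R = (tau%:R - tau%:R / n%:R) / n%:R * ((n%:R - tau%:R) / n%:R).
    by rewrite /weight natrM natrB//; field; rewrite !gt_eqF.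
  apply: ler_wpM2r; first by rewrite divr_ge0 ?ltW.
  rewrite ler_pdivrMr// divfK ?gt_eqF//.
  have : tau%:R / n%:R <= 1 :> R by rewrite ler_pdivrMr// mul1r ler_nat.
  have : t%:R + 1 <= tau%:R :> R by rewrite natr1 ler_nat.
  lra.
- rewrite subrr mul0r subr0.
  set p : R := _ / _.
  have -> : gap 1 (1 - p) s u (n - t) = p * s by rewrite /gap; ring.
  have b_def : p = tau%:R / ((t - tau) + tau)%:R.
    by have -> : ((t - tau) + tau = t)%N by lia.
  have := @gap_edge R (t - tau) tau s u _ _ _ b_def.
  have -> : ((t - tau) + tau = t)%N by lia.
  move=> /(_ _ _)/(ler_wpM2l (weight_ge0 R n t)) H.
  rewrite [X in w t * X]addrC [X in _ <= _ * X]addrC.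
  apply: le_trans (H _ _) _; [lia..|].
  rewrite mulrA ler_wpM2r//; first by rewrite addrC.
  have -> : w t * p = tau%:R / n%:R * ((n%:R - t%:R) / n%:R).
    by rewrite /weight natrM natrB// /p; field; rewrite !gt_eqF.
  have -> : w tau - w tau / n%:R = tau%:R / n%:R * ((n%:R - tau%:R - (n%:R - tau%:R) / n%:R) / n%:R).
    by rewrite /weight natrM natrB//; field; rewrite !gt_eqF.
  apply: ler_wpM2l; first by rewrite divr_ge0 ?ltW.
  rewrite ler_pdivrMr// divfK ?gt_eqF//.
  have : (n%:R - tau%:R) / n%:R <= 1 :> R by rewrite ler_pdivrMr// mul1r gerBl.
  have : tau%:R + 1 <= t%:R :> R by rewrite natr1 ler_nat.
  lra.
Qed.

(* [rho] is the larger root of the quadratic equation stated here; if that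
   equation has no real root, [sqrt] returns 0, [rho < 0] and no permutation is
   balanced. *)
Lemma balanced_rho (pi : 'S_n) : pi \notin unbalanced n m tau (rho R n m tau) ->
  rho R n m tau ^+ 2 / 2 + 2 * A * rho R n m tau + B / 2 = w tau /\
  forall t, admissible n m t ->
    `|pprop R tau pi t - qprop R tau pi t| <= rho R n m tau.
Proof.
rewrite inE -leNgt => H.
have r0 : 0 <= rho R n m tau.
  apply: le_trans H; elim/big_ind: _ => // x y x0 y0; by rewrite le_max x0.
split; last first.
  move=> t mt; apply: le_trans H.
  apply: (le_bigmax_seq 0 t xpredT (fun t => `|pprop R tau pi t - qprop R tau pi t|)) => //.
  by rewrite mem_index_iota ltnS.
have m1 : 0 < m%:R - 1 :> R by rewrite subr_gt0 ltr1n.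
have A0 : 0 < A.
  rewrite divr_gt0// (@weight_gt0 R n m)//.
  by have := mtau; rewrite /admissible; lia.
move: r0; rewrite /rho; set D := 4 * _ + _.
have [D0|D0] := ltP 0 D; last by rewrite ler0_sqrtr//; lra.
have := sqr_sqrtr (ltW D0); set S := Num.sqrt D => SD _.
have -> : (- 2 * A + S) ^+ 2 / 2 + 2 * A * (- 2 * A + S) = (S ^+ 2 - 4 * A ^+ 2) / 2.
  by field; rewrite gt_eqF.
by rewrite SD /D; field; rewrite gt_eqF.
Qed.

(** [gap_ub] with [r] equal to [rho], applied to both gaps, totals
    [rho ^ 2 / 2 + 2 * A * rho + B / 4]. The quadratic equation for [rho] turns this into
    [w tau - B / 4], so a strict margin remains. *)
Lemma noiseless_objective_balanced_le (pi : 'S_n) t u s :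
  pi \notin unbalanced n m tau (rho R n m tau) -> admissible n m t ->
  noiseless_objective pi t u s <= (w tau - B / 4) * (u ^+ 2 + s ^+ 2).
Proof.
move=> /balanced_rho[rhoE bal] mt.
have tn := admissible_le m2 mt; have taun := admissible_le m2 mtau.
have t1 := admissible_gt1 m2 mt; have nt1 := admissible_subn_gt1 m2 mt.
have mnt := admissible_sym m2 mt.
have p01 : 0 <= pprop R tau pi t <= 1 by apply: pprop_ge0_le1; lia.
have q01 : 0 <= 1 - qprop R tau pi t <= 1.
  have : 0 <= qprop R tau pi t <= 1 by apply: qprop_ge0_le1; lia.
  by move=> /andP[q0 q1]; rewrite subr_ge0 q1 gerBl.
have pq' : `|1 - qprop R tau pi t - (1 - pprop R tau pi t)| <= rho R n m tau.
  by apply: le_trans (bal _ mt); rewrite le_eqVlt; apply/orP; left; apply/eqP;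
    congr `|_|; ring.
have w0 := weight_ge0 R n t; have w4 := weight_le R tn.
have hA := weight_ratio_le R m2 mnt; have hB := weight_ratio2_le R m2 mnt.
rewrite weight_sym// in hA hB.
rewrite /noiseless_objective mulrDr.
have h1 := gap_ub u s p01 (bal _ mt) t1 w0 w4 (weight_ratio_le R m2 mt)
  (weight_ratio2_le R m2 mt).
have h2 := gap_ub s u q01 pq' nt1 w0 w4 hA hB.
rewrite [s ^+ 2 + _]addrC in h2.
apply: le_trans (lerD h1 h2) _; rewrite -mulrDl; apply: ler_wpM2r; first by rewrite addr_ge0 ?sqr_ge0.
rewrite -rhoE.
by rewrite le_eqVlt; apply/orP; left; apply/eqP; field; rewrite gt_eqF// subr_gt0 ltr1n.
Qed.

(** The error in a distance is measured relative to the signal [M]. Each gap is at most [5 * M] and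
    moves by at most [2 * (th * M)], so its square moves by at most [24 * (th * M ^+ 2)]; there are
    two squares and [w t <= 1]. *)
Lemma objective_noiseless_le (d : nat) (z : 'I_n -> d.-tuple R) (a11 a12 a22 M th : R)
    (pi : 'S_n) (t : nat) :
  0 <= M -> M ^+ 2 = (a12 - a11) ^+ 2 + (a12 - a22) ^+ 2 -> 0 <= th <= 1 ->
  (forall i j : 'I_n, i != j ->
    `|eucl_dist (z i) (z j) -
      (if (i < tau)%N then (if (j < tau)%N then a11 else a12)
       else (if (j < tau)%N then a12 else a22))| <= th * M) ->
  admissible n m t ->
  `|objective (z \o pi) t - noiseless_objective pi t (a12 - a11) (a12 - a22)| <= 48 * (th * M ^+ 2).
Proof.
move=> M0 ME th01 close mt.
have tn := admissible_le m2 mt; have taun := admissible_le m2 mtau.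
have t1 := admissible_gt1 m2 mt; have nt1 := admissible_subn_gt1 m2 mt.
have p01 : 0 <= pprop R tau pi t <= 1 by apply: pprop_ge0_le1; lia.
have q01 : 0 <= qprop R tau pi t <= 1 by apply: qprop_ge0_le1; lia.
have p01' : 0 <= 1 - pprop R tau pi t <= 1.
  by move: p01 => /andP[? ?]; apply/andP; split; lra.
have q01' : 0 <= 1 - qprop R tau pi t <= 1.
  by move: q01 => /andP[? ?]; apply/andP; split; lra.
have uM : `|a12 - a11| <= M.
  by rewrite -ler_sqr ?nnegrE// real_normK ?num_real// ME lerDl sqr_ge0.
have sM : `|a12 - a22| <= M.
  by rewrite -ler_sqr ?nnegrE// real_normK ?num_real// ME lerDr sqr_ge0.
have g1 := sqr_perturb M0 th01 (gap_norm_le p01 q01 t1 uM sM)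
  (gap_first pi t1 nt1 taun close).
have g2 := sqr_perturb M0 th01 (gap_norm_le q01' p01' nt1 sM uM)
  (gap_second pi t1 nt1 taun close).
rewrite /objective /Dstat /noiseless_objective -mulrBr normrM (ger0_norm (weight_ge0 _ _ _)).
have w1 : w t <= 1 by apply: le_trans (weight_le R tn) _; lra.
rewrite -[leRHS]mul1r; apply: ler_pM => //; first exact: weight_ge0.
rewrite opprD addrACA; apply: le_trans (ler_normD _ _) _.
have -> : 48 * (th * M ^+ 2) = 24 * (th * M ^+ 2) + 24 * (th * M ^+ 2) by ring.
exact: lerD.
Qed.

Lemma Shat_ge (d : nat) (z : 'I_n -> d.-tuple R) t :
  admissible n m t -> objective z t <= Shat m z.
Proof.
move=> mt; apply: (le_bigmax_seq 0 t xpredT (objective z)) => //.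
by rewrite mem_index_iota ltnS.
Qed.

(** The tolerance [th] is fixed before the dimension, the data and the class distances. All that
    remains for the probabilistic part is to show that the distances are this close to their class
    values. *)
Lemma concentration_separates : exists2 th : R, 0 < th &
  forall (d : nat) (z : 'I_n -> d.-tuple R) (a11 a12 a22 M : R),
  0 < M -> M ^+ 2 = (a12 - a11) ^+ 2 + (a12 - a22) ^+ 2 ->
  (forall i j : 'I_n, i != j ->
    `|eucl_dist (z i) (z j) -
      (if (i < tau)%N then (if (j < tau)%N then a11 else a12)
       else (if (j < tau)%N then a12 else a22))| <= th * M) ->
  (forall t, admissible n m t -> t != tau -> objective z t < objective z tau) /\
  (forall pi, pi \notin unbalanced n m tau (rho R n m tau) ->
    Shat m (z \o pi) < Shat m z).
Proof.
have wtau : 0 < w tau := weight_gt0 R m2 mtau.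
have mm : admissible n m m by have := mtau; rewrite /admissible; lia.
have m1 : 0 < m%:R - 1 :> R by rewrite subr_gt0 ltr1n.
have n0 : 0 < n%:R :> R by rewrite ltr0n; have /andP[] := mtau; lia.
have k0 : 0 < Num.min (w tau / n%:R) (B / 4).
  rewrite lt_min; apply/andP; split; first exact: divr_gt0.
  by apply: divr_gt0 => //; apply: divr_gt0; rewrite ?exprn_gt0// (weight_gt0 R m2).
set k := Num.min _ _ in k0.
(* Both objectives compared are off by at most [48 * (th * M ^+ 2)], so [96 * th < k] suffices,
   where [k] is the smaller of the two noiseless margins. The minimum with 1 is for
   [sqr_perturb]. *)
exists (Num.min 1 (k / 200)); first by rewrite lt_min ltr01 divr_gt0.
move=> d z a11 a12 a22 M M0 ME close.
set th := Num.min _ _ in close.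
have th01 : 0 <= th <= 1 by rewrite ge_min lexx le_min ler01 ltW// divr_gt0.
have thk : 96 * (th * M ^+ 2) < k * M ^+ 2.
  rewrite mulrA ltr_pM2r ?exprn_gt0//.
  have : th <= k / 200 by rewrite ge_min lexx orbT.
  lra.
have obj pi t (mt : admissible n m t) := objective_noiseless_le pi (ltW M0) ME th01 close mt.
have zE : z \o (1%g : 'S_n) = z by apply/funext => i /=; rewrite perm1.
have := obj 1%g tau mtau; rewrite zE noiseless_objective_tau -ME ler_distl => /andP[htau _].
have M2 : 0 < M ^+ 2 by rewrite exprn_gt0.
have sep (pi : 'S_n) (t : nat) : admissible n m t ->
    noiseless_objective pi t (a12 - a11) (a12 - a22) <= (w tau - k) * M ^+ 2 ->
    objective (z \o pi) t < objective z tau.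
  move=> mt; have := obj pi t mt; rewrite ler_distl => /andP[_ ht] h.
  rewrite mulrBl in h; lra.
have kw c : k <= c -> (w tau - c) * M ^+ 2 <= (w tau - k) * M ^+ 2.
  by move=> kc; rewrite ler_pM2r// lerB.
split=> [t mt ttau|pi bal].
  rewrite -{1}zE; apply: sep => //.
  apply: le_trans (noiseless_objective_identity_le _ _ mt ttau) _; rewrite -ME; apply: kw.
  by rewrite ge_min lexx.
apply: lt_le_trans (Shat_ge z mtau); rewrite /Shat big_seq; apply: bigmax_lt.
  (* The maximum defining [Shat] starts from [0], so [objective z tau] must also be shown
     positive. *)
  have : 48 * (th * M ^+ 2) < w tau * M ^+ 2.
    have : k * M ^+ 2 <= w tau * M ^+ 2.
      rewrite ler_pM2r// ge_min ler_pdivrMr//; apply/orP; left.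
      by apply: ler_peMr; [exact: ltW | rewrite ler1n -(ltr0n R)].
    have : 0 <= th * M ^+ 2 by rewrite mulr_ge0 ?(ltW M2)//; case/andP: th01.
    lra.
  lra.
move=> t; rewrite mem_index_iota ltnS => mt; apply: sep => //.
apply: le_trans (noiseless_objective_balanced_le _ _ bal mt) _; rewrite -ME; apply: kw.
by rewrite ge_min lexx orbT.
Qed.

End Separation.

(** * The permutation quantile *)

Section Quantile.
Variables (R : realType) (d n m : nat).
Implicit Type z : 'I_n -> d.-tuple R.

Lemma Shat_ge0 z : 0 <= Shat m z.
Proof.
rewrite /Shat; elim/big_ind: _ => // [x y x0 y0|t _]; first by rewrite le_max x0.
by rewrite /objective mulr_ge0 ?addr_ge0 ?sqr_ge0// /weight divr_ge0 ?exprn_ge0.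
Qed.

(* The infimum defining the quantile is eliminated: the quantile is below [S]
   iff the values strictly below [S] already have mass [1 - alpha].  This also
   shows that detection is a measurable event. *)
Lemma perm_quantile_lt_Shat z (alpha : R) : 0 < alpha < 1 ->
  (perm_quantile m z alpha < Shat m z) =
  (1 - alpha <= (n`!%:R)^-1 * \sum_(pi : 'S_n) (Shat m (z \o pi) < Shat m z)%R%:R).
Proof.
move=> /andP[a0 a1].
have f0 : 0 < n`!%:R :> R by rewrite ltr0n fact_gt0.
rewrite /perm_quantile; set E := [set x | _]%classic.
have lbE : has_lbound E by exists 0 => x [].
apply/idP/idP => [qS|h].
- have E0 : E !=set0.
    (* At the maximum over all permutations the whole mass is reached, so the set is nonempty and
       its infimum is a genuine one. *)
    exists (\big[Num.max/0]_(pi : 'S_n) Shat m (z \o pi)); split.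
      exact: bigmax_ge_id.
    rewrite (eq_bigr (fun=> 1)); last by move=> pi _; rewrite le_bigmax.
    rewrite sumr_const card_Sn mulVf ?gt_eqF// gerBl.
    exact: ltW.
  have [x [x0 Ex] xS] := inf_lt E0 qS.
  apply: (le_trans Ex); apply: ler_wpM2l; first by rewrite invr_ge0 ltW.
  apply: ler_sum => pi _; rewrite ler_nat.
  by case: (leP (Shat m (z \o pi)) x) => // Sx; rewrite (le_lt_trans Sx xS).
(* As [alpha < 1], some permuted value is strictly below [Shat m z], which is therefore positive.
   Hence the maximum [x] of all such values, taken from [0], is still strictly below; it carries the
   required mass and bounds the quantile. *)
- have [pi piS] : exists pi : 'S_n, Shat m (z \o pi) < Shat m z.
    apply: contrapT => /forallNP H; move: h.
    rewrite big1 ?mulr0 ?subr_le0 1?leNgt ?a1// => pi _.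
    by have /negP/negbTE -> := H pi.
  pose x := \big[Num.max/0]_(pi : 'S_n | Shat m (z \o pi) < Shat m z) Shat m (z \o pi).
  have xS : x < Shat m z.
    apply: bigmax_lt => //; apply: le_lt_trans piS; exact: Shat_ge0.
  apply: le_lt_trans xS; apply: ge_inf => //; split.
    exact: bigmax_ge_id.
  apply: (le_trans h); apply: ler_wpM2l; first by rewrite invr_ge0 ltW.
  apply: ler_sum => pi' _; rewrite ler_nat.
  by case: (ltP (Shat m (z \o pi')) (Shat m z)) => // Sx; rewrite /x le_bigmax_cond.
Qed.

End Quantile.

(** * Measurability of the statistics and of detection *)

Section Measurability.
Variables (R : realType) (disp : measure_display) (T : measurableType disp).
Variables (d n m : nat) (Z : 'I_n -> T -> d.-tuple R).
Hypothesis mZ : forall i, measurable_fun [set: T] (Z i).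

Lemma measurable_sqdist (X Y : T -> d.-tuple R) :
  measurable_fun [set: T] X -> measurable_fun [set: T] Y ->
  measurable_fun [set: T] (fun x => sqdist (X x) (Y x)).
Proof.
move=> mX mY; apply: measurable_sum => q; apply: measurable_funX.
by apply: measurable_funB; apply: (measurableT_comp (measurable_tnth q)).
Qed.

Lemma measurable_eucl_dist (X Y : T -> d.-tuple R) :
  measurable_fun [set: T] X -> measurable_fun [set: T] Y ->
  measurable_fun [set: T] (fun x => eucl_dist (X x) (Y x)).
Proof.
move=> mX mY.
apply: (@measurableT_comp _ _ _ _ _ _ (@Num.sqrt R)); last exact: measurable_sqdist.
by apply: continuous_measurable_fun; exact: sqrt_continuous.
Qed.

Lemma measurable_objective t : measurable_fun [set: T] (fun x => objective (Z ^~ x) t).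
Proof.
have mS (P : rel 'I_n) (P' : pred 'I_n) : measurable_fun [set: T] (fun x =>
    \sum_(i < n | P' i) \sum_(j < n | P i j) eucl_dist (Z i x) (Z j x)).
  under eq_fun do (rewrite big_mkcond/=; under eq_bigr do rewrite big_mkcond/=).
  apply: measurable_sum => i; case: (P' i); last exact: measurable_cst.
  apply: measurable_sum => j; case: (P i j); last exact: measurable_cst.
  exact: measurable_eucl_dist.
apply: measurable_funM; first exact: measurable_cst.
have m12 : measurable_fun [set: T] (fun x => T12 (Z ^~ x) t).
  by apply: measurable_funM; [exact: measurable_cst | exact: mS].
apply: measurable_funD; apply: measurable_funX; apply: measurable_funB => //;
  apply: measurable_funM; [exact: measurable_cst | exact: (mS _ xpredT) |
  exact: measurable_cst | exact: (mS _ xpredT)].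
Qed.

Lemma measurable_Shat : measurable_fun [set: T] (fun x => Shat m (Z ^~ x)).
Proof.
rewrite /Shat; elim: (index_iota _ _) => [|t s ih].
  by under eq_fun do rewrite big_nil; exact: measurable_cst.
under eq_fun do rewrite big_cons.
by apply: measurable_maxr => //; exact: measurable_objective.
Qed.
End Measurability.

Lemma measurable_detection (R : realType) (disp : measure_display)
    (T : measurableType disp) (d n m : nat) (Z : 'I_n -> T -> d.-tuple R) (alpha : R) :
  0 < alpha < 1 -> (forall i, measurable_fun [set: T] (Z i)) ->
  measurable [set x | perm_quantile m (Z ^~ x) alpha < Shat m (Z ^~ x)].
Proof.
move=> a01 mZ.
under eq_set do rewrite perm_quantile_lt_Shat//.
rewrite -[X in measurable X]setTI.
apply: measurable_fun_le => //.
apply: measurable_funM => //; apply: measurable_sum => pi.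
apply: (@measurableT_comp _ _ _ _ _ _ (fun b : bool => b%:R : R)) => //.
apply: measurable_fun_ltr; last exact: measurable_Shat.
exact: (@measurable_Shat _ _ _ _ _ _ (fun i => Z (pi i))).
Qed.

(** * Moments of one coordinate and the law of a pair *)

Section OneDimensional.
Variables (R : realType) (disp : measure_display) (T : measurableType disp).
Variable P : probability T R.

Lemma Lfun1_le_affine (X Y : T -> R) : measurable_fun [set: T] X ->
  Y \in Lfun P 1 -> (forall x, `|X x| <= 1 + Y x) -> X \in Lfun P 1.
Proof.
move=> mX LY XY; apply/Lfun1_integrable.
have iY1 : P.-integrable [set: T] (EFin \o (cst 1 \+ Y)).
  by apply/Lfun1_integrable; rewrite rpredD//= Lfun_cst.
apply: (le_integrable measurableT _ _ iY1); first exact/measurable_EFinP.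
by move=> x _ /=; rewrite lee_fin (le_trans (XY x)) ?ler_norm.
Qed.

Variable X : T -> R.
Hypothesis mX : measurable_fun [set: T] X.

(** Everything follows from the pointwise bounds [x ^ 2 <= 1 + x ^ 4] and [|x| <= 1 + x ^ 2]. *)
Lemma fourth_moment_Lfun (M : R) : ('E_P[(fun x => X x ^+ 4)%R] <= M%:E)%E ->
  [/\ X \in Lfun P 1, (fun x => X x ^+ 2) \in Lfun P 1 &
    ('E_P[(fun x => X x ^+ 2)%R] <= (1 + M)%:E)%E].
Proof.
move=> hM.
have mX2 : measurable_fun [set: T] (fun x => X x ^+ 2) by exact: measurable_funX.
have mX4 : measurable_fun [set: T] (fun x => X x ^+ 4) by exact: measurable_funX.
have p4 x : 0 <= X x ^+ 4 by rewrite (exprM _ 2 2) sqr_ge0.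
have L4 : (fun x => X x ^+ 4) \in Lfun P 1.
  apply/Lfun1_integrable/integrableP; split; first exact/measurable_EFinP.
  move: hM; rewrite unlock => hM; apply: le_lt_trans (ltry M); apply: le_trans hM.
  rewrite le_eqVlt; apply/orP; left; apply/eqP; apply: eq_integral => x _ /=.
  by rewrite ger0_norm.
have le24 x : X x ^+ 2 <= 1 + X x ^+ 4.
  have := sqr_ge0 (X x ^+ 2 - 1); have := sqr_ge0 (X x).
  rewrite (exprM _ 2 2); nra.
have L2 : (fun x => X x ^+ 2) \in Lfun P 1.
  by apply: (Lfun1_le_affine mX2 L4) => x; rewrite ger0_norm ?sqr_ge0.
split=> //.
  apply: (Lfun1_le_affine mX L2) => x.
  by rewrite ler_norml; apply/andP; split; have := sqr_ge0 (X x - 1);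
    have := sqr_ge0 (X x + 1); nra.
have h : ('E_P[(fun x => X x ^+ 2)%R] <= 'E_P[(cst 1 \+ (fun x => X x ^+ 4))%R])%E.
  apply: expectation_le => //.
  - by apply: measurable_funD.
  - by move=> x; exact: sqr_ge0.
  - by move=> x /=; rewrite addr_ge0.
  - by apply/aeW => x /=.
by apply: (le_trans h); rewrite expectationD ?Lfun_cst// expectation_cst EFinD leeD2l.
Qed.

Lemma expectation_quadratic (a b c : R) :
  X \in Lfun P 1 -> (fun x => X x ^+ 2) \in Lfun P 1 ->
  ('E_P[(fun x => a + b * X x + c * X x ^+ 2)%R] =
   (a + b * fine ('E_P[X])%E + c * fine ('E_P[(fun x => X x ^+ 2)%R])%E)%:E)%E.
Proof.
move=> L1 L2; rewrite [X in expectation _ X](_ : _ =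
  (cst a \+ b \o* X) \+ c \o* (fun x => X x ^+ 2))%R; last first.
  by apply/funext => x /=; rewrite ![_ * b]mulrC ![_ * c]mulrC.
have La : cst a \in Lfun P 1 by exact: Lfun_cst.
have Lb : b \o* X \in Lfun P 1 by exact: Lfun_scale.
have Lc : c \o* (fun x => X x ^+ 2) \in Lfun P 1 by exact: Lfun_scale.
rewrite expectationD ?rpredD//= expectationD// !expectationZl// expectation_cst.
by rewrite !EFinD !EFinM !fineK// expectation_fin_num.
Qed.

Lemma fine_variance : X \in Lfun P 1 -> (fun x => X x ^+ 2) \in Lfun P 1 ->
  fine (covariance P X X) = fine ('E_P[(fun x => X x ^+ 2)%R])%E - fine ('E_P[X])%E ^+ 2.
Proof.
move=> L1 L2; have XX : (X * X)%R = (fun x => X x ^+ 2).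
  by apply/funext => x; rewrite expr2.
rewrite covarianceE// ?XX//.
by rewrite fineB ?fineM ?fin_numM ?expectation_fin_num.
Qed.
End OneDimensional.

(** Independence over the index set [[set i; j]] gives equality on rectangles, and a measure with
    the product values on rectangles is the product measure. *)
Lemma independent_pair_law (R : realType) (disp disp' : measure_display)
    (T : measurableType disp) (T' : measurableType disp') (P : probability T R)
    (n : nat) (Z : 'I_n -> {RV P >-> T'}) (i j : 'I_n) (F G : probability T' R) :
  mutually_independent Z -> i != j ->
  (forall A, measurable A -> distribution P (Z i) A = F A) ->
  (forall A, measurable A -> distribution P (Z j) A = G A) ->
  forall A : set (T' * T'), measurable A ->
    P [set x | A (Z i x, Z j x)] = (F \x G)%E A.
Proof.
move=> indZ ij lawi lawj A mA.
have mp : measurable_fun [set: T] (fun x => (Z i x, Z j x)).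
  exact: measurable_fun_pair.
rewrite (product_measure_unique (m' := distribution P (mfun_Sub (mem_set mp))))//.
move=> B C mB mC.
transitivity (distribution P (Z i) B * distribution P (Z j) C)%E; last first.
  by congr (_ * _)%E; [exact: lawi | exact: lawj].
pose D k := if k == i then B else C.
have mD k : measurable (D k) by rewrite /D; case: ifP.
have := indZ [set i; j]%SET D mD.
rewrite big_setU1 ?inE//= big_set1 /D eqxx eq_sym (negbTE ij) => <-.
congr (P _); apply/seteqP; split => x /=.
  move=> [Bx Cx] k; rewrite !inE => /orP[]/eqP ->; rewrite ?eqxx//.
  by rewrite eq_sym (negbTE ij).
move=> H; split.
  by have := H i; rewrite !inE eqxx => /(_ isT).
by have := H j; rewrite !inE eqxx orbT eq_sym (negbTE ij) => /(_ isT).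
Qed.

(** * Mean and deviation of the squared distance *)

Section SquaredDistance.
Variables (R : realType) (d : nat).
Implicit Types F G : probability (d.-tuple R) R.

Local Notation coord q := (fun x : d.-tuple R => tnth x q).
Local Notation trSigma F := (\tr (cov_matrix F)).

Definition bounded_fourth_moment (M : R) F : Prop :=
  forall q : 'I_d, ('E_F[(fun x => tnth x q ^+ 4)%R] <= M%:E)%E.

Variable M : R.

(** Tonelli is applied coordinate by coordinate, nonnegativity of the squares replacing
    integrability on the product. Integrating out the second point leaves a quadratic in the first,
    so [expectation_quadratic] is used twice. *)
Lemma expectation_sqdist F G :
  bounded_fourth_moment M F -> bounded_fourth_moment M G ->
  ('E_(F \x G)[(fun z : d.-tuple R * d.-tuple R => sqdist z.1 z.2)] =
  (trSigma F + trSigma G + sqdist (mean_vector F) (mean_vector G))%:E)%E.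
Proof.
move=> F4 G4; rewrite unlock /sqdist.
have msq (q : 'I_d) : measurable_fun [set: d.-tuple R * d.-tuple R]
    (fun z => (tnth z.1 q - tnth z.2 q) ^+ 2).
  apply: measurable_funX; apply: measurable_funB;
    apply: (measurableT_comp (measurable_tnth q)) => //.
under eq_integral do rewrite -sumEFin.
rewrite ge0_integral_sum//; last first.
- by move=> q z _; rewrite lee_fin sqr_ge0.
- by move=> q; exact/measurable_EFinP.
rewrite /mxtrace -!big_split/= -sumEFin; apply: eq_bigr => q _.
have mq : measurable_fun [set: d.-tuple R] (coord q) := measurable_tnth q.
have [F1 F2 _] := fourth_moment_Lfun mq (F4 q).
have [G1 G2 _] := fourth_moment_Lfun mq (G4 q).
rewrite fubini_tonelli1//; last first.
- by move=> z; rewrite lee_fin sqr_ge0.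
- exact/measurable_EFinP.
set mF := fine ('E_F[coord q])%E; set mG := fine ('E_G[coord q])%E.
set sF := fine ('E_F[(fun x => tnth x q ^+ 2)%R])%E.
set sG := fine ('E_G[(fun x => tnth x q ^+ 2)%R])%E.
under eq_integral => x _.
  rewrite /fubini_F/= (_ : integral _ _ _ = (sG + (- 2 * mG) * tnth x q + 1 * tnth x q ^+ 2)%:E)%E; last first.
    have := expectation_quadratic (tnth x q ^+ 2) (- 2 * tnth x q) 1 G1 G2.
    rewrite {1}unlock -/mG -/sG => H; transitivity (tnth x q ^+ 2 + - 2 * tnth x q * mG + 1 * sG)%:E.
      by rewrite -H; apply: eq_integral => y _; congr EFin; ring.
    by congr EFin; ring.
  over.
have := expectation_quadratic sG (- 2 * mG) 1 F1 F2; rewrite {1}unlock => ->.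
rewrite -/mF -/sF !mxE !fine_variance// -/mF -/mG -/sF -/sG.
by rewrite !tnth_mktuple -/mF -/mG; congr EFin; ring.
Qed.

End SquaredDistance.

Section SquaredDistanceBounds.
Variables (R : realType) (d : nat).

Lemma expectation_sqdist_le (M : R) (F G : probability (d.-tuple R) R) :
  bounded_fourth_moment M F -> bounded_fourth_moment M G ->
  \tr (cov_matrix F) + \tr (cov_matrix G) + sqdist (mean_vector F) (mean_vector G) <=
  d%:R * (4 * (1 + M)).
Proof.
move=> F4 G4; rewrite /mxtrace /sqdist -!big_split/=.
have -> : d%:R * (4 * (1 + M)) = \sum_(q < d) (4 * (1 + M)).
  by rewrite sumr_const card_ord mulr_natl.
apply: ler_sum => q _.
have mq : measurable_fun [set: d.-tuple R] (fun x : d.-tuple R => tnth x q) :=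
  measurable_tnth q.
have [F1 F2 F2M] := fourth_moment_Lfun mq (F4 q).
have [G1 G2 G2M] := fourth_moment_Lfun mq (G4 q).
have VF : 0 <= fine (covariance F (fun x => tnth x q) (fun x => tnth x q)).
  by apply: fine_ge0; exact: variance_ge0.
have VG : 0 <= fine (covariance G (fun x => tnth x q) (fun x => tnth x q)).
  by apply: fine_ge0; exact: variance_ge0.
rewrite -(fineK (expectation_fin_num F2)) lee_fin in F2M.
rewrite -(fineK (expectation_fin_num G2)) lee_fin in G2M.
rewrite !mxE !tnth_mktuple; move: VF VG; rewrite !fine_variance//.
set a := fine _ in F2M *; set b := fine _.
set a' := fine _ in G2M *; set b' := fine _.
(* The summand is [a + a' - 2 * b * b']. Nonnegative variances give [b ^+ 2 <= a] and
   [b' ^+ 2 <= a'], so it is at most [2 * (a + a')]. *)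
move=> VF VG; have := sqr_ge0 (b + b'); nra.
Qed.

Lemma chebyshev_sqdist (F G : probability (d.-tuple R) R) (lam mu V : R) :
  0 < lam ->
  ('E_(F \x G)[(fun z : d.-tuple R * d.-tuple R => sqdist z.1 z.2)] = mu%:E)%E ->
  0 < var_sqdist F G <= V ->
  ((F \x G)%E [set z : d.-tuple R * d.-tuple R | (lam <= `|sqdist z.1 z.2 - mu|)%R]
    <= (V / lam ^+ 2)%:E)%E.
Proof.
move=> lam0 mean /andP[V0 VV].
have ms : measurable_fun [set: d.-tuple R * d.-tuple R] (fun z => sqdist z.1 z.2).
  exact: measurable_sqdist.
have := @chebyshev _ _ R (F \x G)%E (mfun_Sub (mem_set ms)) lam lam0.
rewrite [X in expectation _ X](_ : _ = fun z => sqdist z.1 z.2)// mean/=.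
move=> H; apply: (le_trans H).
(* [fine] sends infinite values to [0], so positivity of [var_sqdist F G] forces the variance to be
   finite. *)
move: V0 VV; rewrite /var_sqdist.
case: ('V_(F \x G)[fun z => sqdist z.1 z.2])%E => [v| |]/=; rewrite ?ltxx//.
by move=> v0 vV; rewrite -EFinM lee_fin mulrC ler_wpM2r// invr_ge0 exprn_ge0 ?ltW.
Qed.

Lemma sqr_eucl_dist (x y : d.-tuple R) : eucl_dist x y ^+ 2 = sqdist x y.
Proof. by rewrite sqr_sqrtr// sumr_ge0// => q _; exact: sqr_ge0. Qed.

Lemma sqdist_ge0 (x y : d.-tuple R) : 0 <= sqdist x y.
Proof. by rewrite -sqr_eucl_dist sqr_ge0. Qed.

Lemma sqdistxx (x : d.-tuple R) : sqdist x x = 0.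
Proof. by rewrite /sqdist big1// => q _; rewrite subrr expr0n. Qed.

End SquaredDistanceBounds.

(** * From concentration of the distances to probability limits *)

Lemma union_bound (R : realType) (disp : measure_display) (T : measurableType disp)
    (P : probability T R) (I : finType) (Q : pred I) (B : I -> set T) (S : set T)
    (e : R) :
  (forall i, measurable (B i)) -> measurable S ->
  (forall i, Q i -> (P (B i) <= e%:E)%E) -> 0 <= e ->
  (forall x, ~ S x -> exists2 i, Q i & B i x) ->
  ((1 - #|I|%:R * e)%:E <= P S)%E.
Proof.
move=> mB mS Be e0 SB.
have H : (P (~` S) <= (#|I|%:R * e)%:E)%E.
  pose U := \big[setU/set0]_(i | Q i) B i.
  have mU : measurable U by exact: bigsetU_measurable.
  have SU : ~` S `<=` U.
    move=> x /SB[i Qi Bix]; rewrite /U (bigD1 i)//=; by left.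
  apply: (@le_trans _ _ (P U)).
    by apply: le_measure => //; rewrite inE//; exact: measurableC.
  have Us (r : seq I) : (P (\big[setU/set0]_(i <- r | Q i) B i) <=
      (\sum_(i <- r | Q i) e)%:E)%E.
    elim: r => [|i r ih]; first by rewrite !big_nil measure0.
    rewrite !big_cons; case: ifP => // Qi; rewrite EFinD.
    apply: le_trans (measureU2 _ _ _) _ => //; first exact: bigsetU_measurable.
    by apply: leeD => //; exact: Be.
  apply: (le_trans (Us _)); rewrite lee_fin sumr_const -(mulr_natl e); apply: ler_wpM2r => //; rewrite ler_nat.
  exact: max_card.
rewrite probability_setC// in H.
move: H; rewrite -(fineK (fin_num_measure P S mS)) -EFinB !lee_fin => H.
by rewrite lerBlDr addrC -lerBlDr.
Qed.

(** Only [B] is bounded away from [0]: [A] will be a random squared distance and [B] its mean. *)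
Lemma sqrt_dist_le (R : realType) (A B c : R) : 0 <= A -> 0 < c -> c <= B ->
  `|Num.sqrt A - Num.sqrt B| <= `|A - B| / Num.sqrt c.
Proof.
move=> A0 c0 cB; rewrite ler_pdivlMr ?sqrtr_gt0//.
have B0 : 0 <= B by apply: le_trans cB; exact: ltW.
have -> : `|A - B| = `|Num.sqrt A - Num.sqrt B| * (Num.sqrt A + Num.sqrt B).
  rewrite -[Num.sqrt A + Num.sqrt B]ger0_norm ?addr_ge0 ?sqrtr_ge0// -normrM -subr_sqr.
  by rewrite !sqr_sqrtr.
apply: ler_wpM2l => //; apply: le_trans (_ : Num.sqrt B <= _).
  by rewrite ler_wsqrtr.
by rewrite lerDr sqrtr_ge0.
Qed.

(** Factoring [E12 - E] as a difference of squares gives [s <= 2 * M * sqrt (K * D)]. Conversely,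
    passing from squared distances to distances divides an error by at least [sqrt (c * D)]. The
    powers of [D] cancel, and the factor [sqrt c / (2 * sqrt K)] leaves [th * M]. *)
Lemma signal_noise (R : realType) (c K D s E11 E12 E22 : R) :
  0 < c -> 0 < K -> 0 < D -> 0 < s ->
  (forall E, E \in [:: E11; E12; E22] -> c * D <= E <= K * D) ->
  s <= Num.max `|E12 - E11| `|E12 - E22| ->
  let M := Num.sqrt ((Num.sqrt E12 - Num.sqrt E11) ^+ 2 +
                     (Num.sqrt E12 - Num.sqrt E22) ^+ 2) in
  0 < M /\ forall th A E, 0 < th -> 0 <= A -> E \in [:: E11; E12; E22] ->
    `|A - E| <= th * (Num.sqrt c / (2 * Num.sqrt K)) * s ->
    `|Num.sqrt A - Num.sqrt E| <= th * M.
Proof.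
move=> c0 K0 D0 s0 Eb sE M.
have cD : 0 < c * D by exact: mulr_gt0.
have sc : 0 < Num.sqrt c by rewrite sqrtr_gt0.
have sK : 0 < Num.sqrt K by rewrite sqrtr_gt0.
have sD : 0 < Num.sqrt D by rewrite sqrtr_gt0.
have E0 E : E \in [:: E11; E12; E22] -> 0 <= E.
  by move=> /Eb/andP[h _]; apply: le_trans h; exact: ltW.
have ub E : E \in [:: E11; E12; E22] -> Num.sqrt E <= Num.sqrt K * Num.sqrt D.
  by move=> /Eb/andP[_ h]; rewrite -(sqrtrM _ (ltW K0)) ler_wsqrtr.
have diff E : E \in [:: E11; E12; E22] ->
    `|E12 - E| <= `|Num.sqrt E12 - Num.sqrt E| * (2 * (Num.sqrt K * Num.sqrt D)).
  move=> Ein; have -> : `|E12 - E| = `|Num.sqrt E12 - Num.sqrt E| * (Num.sqrt E12 + Num.sqrt E).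
    rewrite -[Num.sqrt E12 + Num.sqrt E]ger0_norm ?addr_ge0 ?sqrtr_ge0// -normrM -subr_sqr.
    by rewrite !sqr_sqrtr ?E0// !inE eqxx orbT.
  apply: ler_wpM2l => //; rewrite mulr_natl mulr2n lerD ?ub// !inE eqxx orbT//.
have M0 : 0 <= M by exact: sqrtr_ge0.
have M2 : M ^+ 2 = (Num.sqrt E12 - Num.sqrt E11) ^+ 2 +
    (Num.sqrt E12 - Num.sqrt E22) ^+ 2.
  by rewrite sqr_sqrtr// addr_ge0 ?sqr_ge0.
have uM : `|Num.sqrt E12 - Num.sqrt E11| <= M.
  by rewrite -ler_sqr ?nnegrE// real_normK ?num_real// M2 lerDl sqr_ge0.
have vM : `|Num.sqrt E12 - Num.sqrt E22| <= M.
  by rewrite -ler_sqr ?nnegrE// real_normK ?num_real// M2 lerDr sqr_ge0.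
have sM : s <= M * (2 * (Num.sqrt K * Num.sqrt D)).
  apply: (le_trans sE); rewrite ge_max; apply/andP; split.
    apply: le_trans (diff _ _) _; first by rewrite !inE eqxx.
    by rewrite ler_wpM2r// !mulr_ge0 ?sqrtr_ge0.
  apply: le_trans (diff _ _) _; first by rewrite !inE eqxx !orbT.
  by rewrite ler_wpM2r// !mulr_ge0 ?sqrtr_ge0.
split=> [|th A E th0 A0 Ein AE].
  rewrite lt_def M0 andbT; apply/eqP => M00.
  by move: sM; rewrite M00 mul0r leNgt s0.
have /andP[cE _] := Eb _ Ein.
apply: le_trans (sqrt_dist_le A0 cD cE) _.
rewrite ler_pdivrMr ?sqrtr_gt0// (sqrtrM _ (ltW c0)).
apply: (le_trans AE).
apply: (@le_trans _ _ (th * (Num.sqrt c / (2 * Num.sqrt K)) * (M * (2 * (Num.sqrt K * Num.sqrt D))))).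
  by rewrite ler_wpM2l// !mulr_ge0 ?invr_ge0 ?mulr_ge0 ?sqrtr_ge0 ?ltW.
by rewrite le_eqVlt; apply/orP; left; apply/eqP; field; rewrite gt_eqF.
Qed.

(** The liminf is the supremum of the tail infima, so one of these is positive. It is finite, being
    at most a term of the sequence, and serves as [c]. *)
Lemma limn_einf_gt0 (R : realType) (u : nat -> R) :
  (0 < limn_einf (fun d => (u d)%:E))%E -> exists2 c, 0 < c & \forall d \near \oo, c <= u d.
Proof.
rewrite limn_einf_lim (cvg_lim _ (@cvg_einfs_sup _ _))// => /ereal_sup_gt[y [N _ <-] y0].
have le k : (N <= k)%N -> (einfs (fun d => (u d)%:E) N <= (u k)%:E)%E.
  by move=> Nk; apply: ereal_inf_lbound; exists k.
have fin : einfs (fun d => (u d)%:E) N \is a fin_num.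
  by rewrite ge0_fin_numE ?(ltW y0)// (le_lt_trans (le N _))// ltry.
exists (fine (einfs (fun d => (u d)%:E) N)).
  by rewrite fine_gt0// y0 -ge0_fin_numE// ltW.
exists N => // k /= Nk; rewrite -lee_fin fineK//; exact: le.
Qed.

(** The permutations outside [U] have mass at least [1 - alpha] and all lie strictly below
    [Shat m z], which is the criterion of [perm_quantile_lt_Shat]. *)
Lemma detected_of_dominated (R : realType) (d n m : nat) (z : 'I_n -> d.-tuple R)
    (alpha : R) (U : {set 'S_n}) : 0 < alpha < 1 -> #|U|%:R / n`!%:R <= alpha ->
  (forall pi, pi \notin U -> Shat m (z \o pi) < Shat m z) ->
  perm_quantile m z alpha < Shat m z.
Proof.
move=> a01 Ua US; rewrite perm_quantile_lt_Shat//.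
have f0 : 0 < n`!%:R :> R by rewrite ltr0n fact_gt0.
apply: (@le_trans _ _ (n`!%:R^-1 * #|~: U|%:R)).
  have := cardsC U; rewrite card_Sn => /(congr1 (fun k => k%:R : R)).
  rewrite natrD => /eqP; rewrite eq_sym addrC -subr_eq => /eqP <-.
  by rewrite mulrBr mulVf ?gt_eqF// lerB// mulrC.
apply: ler_wpM2l; first by rewrite invr_ge0 ltW.
rewrite -sum1_card natr_sum big_mkcond/=; apply: ler_sum => pi _.
by rewrite inE; case: ifP => // /US ->.
Qed.

Lemma cvg_probability1 (R : realType) (disp : nat -> measure_display)
    (T : forall d, measurableType (disp d)) (P : forall d, probability (T d) R)
    (S : forall d, set (T d)) (h : nat -> R) (C : R) :
  (forall d, measurable (S d)) -> (h d @[d --> \oo] --> +oo) ->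
  (\forall d \near \oo, ((1 - C * (h d)^-1 ^+ 2)%:E <= P d (S d))%E) ->
  P d (S d) @[d --> \oo] --> 1%E.
Proof.
move=> mS hy lb.
have h0 : \forall d \near \oo, 0 < h d by exact: (cvgryPgt h).1 hy 0.
have hV : (h d)^-1 @[d --> \oo] --> (0 : R) by apply/gtr0_cvgV0.
apply: (@squeeze_cvge _ _ _ _ (fun d => (1 - C * (h d)^-1 ^+ 2)%:E) _ (fun=> 1%E)).
- near=> d; apply/andP; split; first by near: d.
  exact: probability_le1.
- apply: cvg_EFin; first exact: nearW.
  rewrite -[X in _ --> X](_ : 1 - C * (0 * 0) = 1); last by rewrite !mulr0 subr0.
  apply: cvgB; first exact: cvg_cst.
  by apply: cvgM; [exact: cvg_cst | exact: cvgM].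
- exact: cvg_cst.
Unshelve. all: by end_near.
Qed.

(** * Consistency and detection in high dimension *)

Lemma ord2_cases (r : 'I_2) : r = 0 \/ r = 1.
Proof.
by case: r => [[|[|k]] ltk]//; [left | right]; apply/val_inj.
Qed.

Theorem theorem4 (R : realType) (n tau : nat) (delta : R)
  (* F 0 and F 1 are the distributions F_1 and F_2 *)
  (F : 'I_2 -> forall d : nat, probability (d.-tuple R) R)
  (disp : nat -> measure_display)
  (Omega : forall d : nat, measurableType (disp d))
  (P : forall d : nat, probability (Omega d) R)
  (Z : forall d : nat, 'I_n -> {RV (P d) >-> d.-tuple R})
  (That : forall d : nat, {RV (P d) >-> nat})
  (v2 : 'I_2 -> 'I_2 -> nat -> R) :
  let m := trim n delta in
  let z := fun (d : nat) (x : Omega d) (i : 'I_n) => Z d i x in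
  let v := fun d : nat =>
    Num.sqrt (Num.max (Num.max (v2 0 0 d) (v2 0 1 d)) (v2 1 1 d)) in
  let mu := fun (r : 'I_2) (d : nat) => mean_vector (F r d) in
  let trSigma := fun (r : 'I_2) (d : nat) => \tr (cov_matrix (F r d)) in
  0 < delta < 2^-1 ->
  (2 <= m)%N ->
  admissible n m tau ->
  (forall d, mutually_independent (Z d)) ->
  (forall d (i : 'I_n) (A : set (d.-tuple R)), measurable A ->
     distribution (P d) (Z d i) A = F (if (i < tau)%N then 0 else 1) d A) ->
  (forall d (x : Omega d), is_argmax m (z d x) (That d x)) ->
  (* (A1) *)
  (exists M : R, forall (r : 'I_2) (d : nat) (q : 'I_d),
     ('E_(F r d)[(fun x : d.-tuple R => tnth x q ^+ 4)%R] <= M%:E)%E) ->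
  (* (A2) *)
  (forall r s : 'I_2,
     (fun d : nat => sum_abs_corr (F r d) (F s d)) =o_\oo
     (fun d : nat => d%:R ^+ 2 : R)) ->
  (forall r s d, 0 < v2 r s d) ->
  (forall r s, same_order (fun d => var_sqdist (F r d) (F s d)) (v2 r s)) ->
  (0 < limn_einf (fun d : nat =>
         (Num.min (trSigma 0 d) (trSigma 1 d) / d%:R)%:E))%E ->
  ((eucl_dist (mu 0 d) (mu 1 d) ^+ 2 / v d @[d --> \oo] --> +oo) \/
   (`|trSigma 0 d - trSigma 1 d| / v d @[d --> \oo] --> +oo)) ->
  (P d [set x | That d x = tau] @[d --> \oo] --> 1%E) /\
  (forall alpha : R, 0 < alpha < 1 ->
     #|unbalanced n m tau (rho R n m tau)|%:R / n`!%:R <= alpha ->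
     P d [set x | That d x = tau /\
                  perm_quantile m (z d x) alpha < Shat m (z d x)]
       @[d --> \oo] --> 1%E).

move=> m z v mu trS d01 m2 mtau ind law amax [M A1] _ v2pos ord liminf signal.
pose lab (i : 'I_n) : 'I_2 := if (i < tau)%N then 0 else 1.
pose E r s d := trS r d + trS s d + sqdist (mu r d) (mu s d).
(* Adding the location and scale signals treats both alternatives of the hypothesis at once. *)
pose Sig d := eucl_dist (mu 0 d) (mu 1 d) ^+ 2 + `|trS 0 d - trS 1 d|.
have [th th0 sep] := concentration_separates R m2 mtau.
have [c c0 hc] := limn_einf_gt0 liminf.
pose K : R := 1 + `|4 * (1 + M)|.
have K0 : 0 < K by rewrite ltr_pwDl.
(* The tolerance on squared distances, relative to [Sig], for which [signal_noise] gives the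
   tolerance [th] on distances. *)
pose thp := th * (Num.sqrt c / (2 * Num.sqrt K)).
have thp0 : 0 < thp by rewrite mulr_gt0// divr_gt0 ?mulr_gt0 ?sqrtr_gt0.
have v0 d : 0 < v d by rewrite sqrtr_gt0 !lt_max v2pos.
have Sigv : Sig d / v d @[d --> \oo] --> +oo.
  have Sige d A : A <= Sig d -> A / v d <= Sig d / v d.
    by move=> h; rewrite ler_pM2r ?invr_gt0.
  apply/cvgryPge => A; case: signal => /cvgryPge/(_ A); apply: filterS => d hA;
    apply: (le_trans hA); apply: Sige; rewrite /Sig.
  - by rewrite lerDl.
  - by rewrite lerDr sqr_ge0.
have v2le d (r s : 'I_2) : (r <= s)%N -> v2 r s d <= v d ^+ 2.
  rewrite sqr_sqrtr; last by rewrite !le_max ltW ?v2pos.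
  by case: (ord2_cases r) => ->; case: (ord2_cases s) => ->//= _;
    rewrite !le_max lexx ?orbT.
(* The upper bound feeds Chebyshev; positivity, from the lower half of [same_order], ensures that
   the variance is finite. *)
have [C C0 varC] : exists2 C : R, 0 <= C & \forall d \near \oo,
    forall r s : 'I_2, (r <= s)%N -> 0 < var_sqdist (F r d) (F s d) <= C * v d ^+ 2.
  have one (r s : 'I_2) : exists2 C : R, 0 <= C & \forall d \near \oo,
      (r <= s)%N -> 0 < var_sqdist (F r d) (F s d) <= C * v d ^+ 2.
    have [c' [C' [c'0 hC']]] := ord r s.
    exists `|C'| => //; move: hC'; apply: filterS => d /andP[h1 h2] rs.
    rewrite ler_pdivlMr// in h1; rewrite ler_pdivrMr// in h2.
    rewrite (lt_le_trans _ h1) ?mulr_gt0//=; apply: (le_trans h2).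
    apply: (@le_trans _ _ (`|C'| * v2 r s d)); first by rewrite ler_pM2r// ler_norm.
    by rewrite ler_wpM2l// v2le.
  have [C00 p00 h00] := one 0 0; have [C01 p01 h01] := one 0 1.
  have [C11 p11 h11] := one 1 1.
  exists (C00 + C01 + C11); first by rewrite !addr_ge0.
  apply: filterS3 h00 h01 h11 => d H00 H01 H11 r s.
  have /andP[q00 l00] := H00 isT; have /andP[q01 l01] := H01 isT.
  have /andP[q11 l11] := H11 isT.
  have V2 := sqr_ge0 (v d).
  have b00 : 0 <= C00 * v d ^+ 2 by rewrite mulr_ge0.
  have b01 : 0 <= C01 * v d ^+ 2 by rewrite mulr_ge0.
  have b11 : 0 <= C11 * v d ^+ 2 by rewrite mulr_ge0.
  rewrite !mulrDl.
  by case: (ord2_cases r) => ->; case: (ord2_cases s) => -> // _;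
    rewrite ?q00 ?q01 ?q11/=; lra.
have F4 r d : bounded_fourth_moment M (F r d) by move=> q; exact: A1.
pose far d (p : 'I_n * 'I_n) : set (Omega d) := [set x |
  thp * Sig d <= `|sqdist (Z d p.1 x) (Z d p.2 x) - E (lab p.1) (lab p.2) d|].
have mZ d i : measurable_fun [set: Omega d] (Z d i) by [].
have far_prob : \forall d \near \oo, 0 < Sig d -> forall p : 'I_n * 'I_n, (p.1 < p.2)%N ->
    (P d (far d p) <= (C / thp ^+ 2 * (Sig d / v d)^-1 ^+ 2)%:E)%E.
  move: varC; apply: filterS => d hV S0 [i j]/= ij.
  have labij : (lab i <= lab j)%N.
    by rewrite /lab; case: (ltnP j tau) => jt; [rewrite (ltn_trans ij jt)|case: ifP].
  have ms : measurable [set w : d.-tuple R * d.-tuple R |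
      thp * Sig d <= `|sqdist w.1 w.2 - E (lab i) (lab j) d|].
    rewrite -[X in measurable X]setTI; apply: measurable_fun_le => //.
    apply: measurableT_comp => //; apply: measurable_funB => //.
    exact: measurable_sqdist.
  have ne : i != j by rewrite -val_eqE neq_ltn ij.
  have := independent_pair_law (ind d) ne (law d i) (law d j) ms.
  rewrite /far/= => ->.
  have lam0 : 0 < thp * Sig d by rewrite mulr_gt0.
  have := chebyshev_sqdist lam0 (expectation_sqdist (F4 (lab i) d) (F4 (lab j) d))
    (hV _ _ labij).
  move=> H; apply: (le_trans H); rewrite lee_fin le_eqVlt; apply/orP; left; apply/eqP.
  by field; rewrite !gt_eqF.
(* The constant is chosen before the events [S], so that it serves both conclusions. *)
have far_union : exists C', forall S : (forall d, set (Omega d)),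
    (forall d, measurable (S d)) ->
    (\forall d \near \oo, forall x, (forall p : 'I_n * 'I_n, (p.1 < p.2)%N -> ~ far d p x) -> S d x) ->
    (\forall d \near \oo, ((1 - C' * (Sig d / v d)^-1 ^+ 2)%:E <= P d (S d))%E).
  exists (#|{: 'I_n * 'I_n}|%:R * (C / thp ^+ 2)) => S mS hS.
  near=> d.
  have S0 : 0 < Sig d.
    have : 0 < Sig d / v d by near: d; exact: (cvgryPgt _).1 Sigv 0.
    by rewrite pmulr_lgt0 ?invr_gt0.
  have hfar : forall p : 'I_n * 'I_n, (p.1 < p.2)%N ->
      (P d (far d p) <= (C / thp ^+ 2 * (Sig d / v d)^-1 ^+ 2)%:E)%E.
    by move: S0; near: d.
  rewrite -mulrA; apply: (@union_bound _ _ _ (P d) _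
    (fun p : 'I_n * 'I_n => (p.1 < p.2)%N) (far d)) => //.
  - move=> p; rewrite /far -[X in measurable X]setTI; apply: measurable_fun_le => //.
    apply: measurableT_comp => //; apply: measurable_funB => //.
    exact: measurable_sqdist.
  - by rewrite mulr_ge0 ?sqr_ge0// divr_ge0// sqr_ge0.
  - have hSd : forall x, (forall p : 'I_n * 'I_n, (p.1 < p.2)%N -> ~ far d p x) -> S d x by near: d.
    move=> x nSx; apply: contrapT => H; apply: nSx; apply: hSd => p pp fp.
    by apply: H; exists p.
have [C' hC'] := far_union.
have close : \forall d \near \oo, forall x : Omega d,
    (forall p : 'I_n * 'I_n, (p.1 < p.2)%N -> ~ far d p x) ->
    (forall t, admissible n m t -> t != tau -> objective (z d x) t < objective (z d x) tau) /\
    (forall pi, pi \notin unbalanced n m tau (rho R n m tau) ->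
      Shat m (z d x \o pi) < Shat m (z d x)).
  near=> d => x good.
  have d0 : 0 < d%:R :> R by rewrite ltr0n; near: d; exact: nbhs_infty_gt.
  have S0 : 0 < Sig d.
    have : 0 < Sig d / v d by near: d; exact: (cvgryPgt _).1 Sigv 0.
    by rewrite pmulr_lgt0 ?invr_gt0.
  have tr_lb r : c * d%:R <= trS r d.
    have : c <= Num.min (trS 0 d) (trS 1 d) / d%:R by near: d.
    rewrite ler_pdivlMr// le_min => /andP[h0 h1].
    by case: (ord2_cases r) => ->.
  have E_bd r s : c * d%:R <= E r s d <= K * d%:R.
    apply/andP; split.
      have := tr_lb r; have := tr_lb s; have := sqdist_ge0 (mu r d) (mu s d).
      have : 0 <= c * d%:R by rewrite mulr_ge0 ?ltW.
      rewrite /E; lra.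
    have := expectation_sqdist_le (F4 r d) (F4 s d) => /le_trans; apply.
    rewrite mulrC ler_pM2r// /K; have := ler_norm (4 * (1 + M)); lra.
  have Err r : E r r d = 2 * trS r d by rewrite /E sqdistxx; ring.
  have E01 : E 0 1 d = trS 0 d + trS 1 d + eucl_dist (mu 0 d) (mu 1 d) ^+ 2.
    by rewrite sqr_eucl_dist.
  have Eb e : e \in [:: E 0 0 d; E 0 1 d; E 1 1 d] -> c * d%:R <= e <= K * d%:R.
    by rewrite !inE => /or3P[] /eqP ->.
  (* The two differences are the squared mean distance plus opposite trace differences, so the one
     whose trace difference is nonnegative equals [Sig d]. *)
  have Sig_le : Sig d <= Num.max `|E 0 1 d - E 0 0 d| `|E 0 1 d - E 1 1 d|.
    rewrite !Err E01 le_max /Sig.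
    have := sqr_ge0 (eucl_dist (mu 0 d) (mu 1 d)); set q := _ ^+ 2 => q0.
    case: (leP 0 (trS 0 d - trS 1 d)) => hs.
      apply/orP; right; apply: le_trans (ler_norm _).
      rewrite (ger0_norm hs); lra.
    apply/orP; left; apply: le_trans (ler_norm _).
    rewrite (ltr0_norm hs); lra.
  have [M0 near_sqrt] := signal_noise c0 K0 d0 S0 Eb Sig_le.
  apply: (@sep d (z d x) (Num.sqrt (E 0 0 d)) (Num.sqrt (E 0 1 d)) (Num.sqrt (E 1 1 d)) _ M0).
    by rewrite sqr_sqrtr// addr_ge0 ?sqr_ge0.
  (* Pairs are ordered so that [F_2 x F_1], whose order [v2 1 0] is not part of
     [v], never occurs. *)
  have lt_case (i j : 'I_n) : (i < j)%N ->
      `|eucl_dist (z d x i) (z d x j) -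
        (if (i < tau)%N
         then (if (j < tau)%N then Num.sqrt (E 0 0 d) else Num.sqrt (E 0 1 d))
         else (if (j < tau)%N then Num.sqrt (E 0 1 d) else Num.sqrt (E 1 1 d)))| <=
      th * Num.sqrt ((Num.sqrt (E 0 1 d) - Num.sqrt (E 0 0 d)) ^+ 2 +
                     (Num.sqrt (E 0 1 d) - Num.sqrt (E 1 1 d)) ^+ 2).
    move=> ij; have /negP := good (i, j) ij; rewrite /far/= -ltNge => /ltW.
    rewrite /lab; have [it|it] := ltnP i tau; have [jt|jt] := ltnP j tau => h.
    - by apply: near_sqrt => //; [exact: sqdist_ge0 | rewrite !inE eqxx].
    - by apply: near_sqrt => //; [exact: sqdist_ge0 | rewrite !inE eqxx orbT].
    - by move: (leq_ltn_trans it (ltn_trans ij jt)); rewrite ltnn.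
    - by apply: near_sqrt => //; [exact: sqdist_ge0 | rewrite !inE eqxx !orbT].
  move=> i j; rewrite -val_eqE neq_ltn => /orP[|ji]; first exact: lt_case.
  have := lt_case j i ji; rewrite eucl_distC.
  by case: (ltnP i tau) => it; case: (ltnP j tau) => jt.
(* Strict inequality makes [tau] the unique maximizer, so any choice of [That] must return it. *)
have That_tau d x : (forall t, admissible n m t -> t != tau ->
    objective (z d x) t < objective (z d x) tau) -> That d x = tau.
  move=> H; apply/eqP/negPn/negP => ne; have [adm mx] := amax d x.
  by have := H _ adm ne; rewrite ltNge mx.
have mThat d : measurable [set x | That d x = tau].
  by rewrite -[X in measurable X]setTI; exact: (measurable_funP (That d) measurableT [set tau]).
split.
  apply: (cvg_probability1 mThat Sigv); apply: hC' => //.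
  by move: close; apply: filterS => d H x /H[/That_tau].
move=> alpha a01 hB.
have mdet d : measurable [set x | That d x = tau /\
    perm_quantile m (z d x) alpha < Shat m (z d x)].
  by apply: measurableI => //; exact: (measurable_detection m a01 (mZ d)).
apply: (cvg_probability1 mdet Sigv); apply: hC' => //.
move: close; apply: filterS => d H x /H[/That_tau ? bal]; split=> //.
exact: detected_of_dominated bal.
Unshelve. all: by end_near.
Qed.
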